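(* Let $\mathcal O=\mathcal{C}l(s,t)$, $k=2^{s+t}$, $m\in\mathbb N$, and let $M$ be an almost Cliffordian manifold of dimension $km$ based on $\mathcal O$ with $\dim M\ge 2(s+t)$, i.e. a smooth manifold equipped with a $G$-structure where $G=GL(m,\mathcal O)GL(1,\mathcal O)$, or equivalently with an $A$-structure where $A=\mathcal O$. Let $\mathbb V=\mathbb R^{km}$, let $\mathfrak g$ be the Lie algebra of $G$, and let $\mathcal D$ be a $G$-invariant complement of $\partial(\mathfrak g\otimes\mathbb V^* )$ in $\mathbb V\otimes\wedge^2\mathbb V^*$. Then the class of $\mathcal D$-connections preserving $A$ and sharing the same $A$-planar curves is isomorphic to $(\mathbb R^{km})^*$; that is, fixing one $\mathcal D$-connection $\nabla$, the $\mathcal D$-connections that preserve $A$ and have the same $A$-planar curves as $\nabla$ are exactly $\nabla+S$, where $S$ ranges over the sections of a vector bundle of tensors whose fibres are isomorphic to $(\mathbb R^{km})^*$.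
   Context: The Clifford algebra $\mathcal O=\mathcal{C}l(s,t)$ is the real associative unital algebra of dimension $k=2^{s+t}$ generated by pairwise anticommuting elements $I_1,\dots,I_t$ with $I_i^2=-E$ and $J_1,\dots,J_s$ with $J_j^2=E$, $E$ the unit. Its standard basis $F_1,\dots,F_k$ consists of $F_1=E$, the generators, and all products of two or more distinct generators. These act on $\mathbb V=\mathcal O^m=\mathbb R^{km}$ blockwise through a matrix representation of $\mathcal O$ on $\mathbb R^k$. $GL(m,\mathcal O)=\{B\in GL(km,\mathbb R): BI_i=I_iB,\ BJ_j=J_jB\}$; $GL(1,\mathcal O)$ acts on $\mathbb V$ blockwise as the group of invertible elements of $\langle F_1,\dots,F_k\rangle$; $G=GL(m,\mathcal O)GL(1,\mathcal O)$ is the group of products. A $G$-structure on $M$ is a reduction $P$ of the frame bundle $P^1M$ to $G$. An $\ell$-dimensional $A$-structure on $M$ is a smooth rank-$\ell$ vector subbundle $A\subset T^*M\otimes TM$, $\ell<\dim M$, with $\mathrm{id}_{T_xM}\in A_x$ for all $x$. For an almost Cliffordian manifold, $A=\langle F_1,\dots,F_k\rangle$ is the subbundle determined by the $G$-structure, where $F_1,\dots,F_k$ are affinors ($(1,1)$-tensors) which in general are defined only locally. A connection $\nabla$ preserves $A$ if $\nabla A=0$, i.e. covariant differentiation preserves sections of $A$. For $X\in T_xM$ put $A(X)=\{F(X):F\in A_x\}$; a curve $c:\mathbb R\to M$ is $A$-planar with respect to $\nabla$ if $\nabla_{\dot c}\dot c\in A(\dot c)$. $\partial:\mathfrak g\otimes\mathbb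 V^*=\mathrm{Hom}(\mathbb V,\mathfrak g)\to\mathbb V\otimes\wedge^2\mathbb V^*$ is the Spencer operator of alternation. Given a $G$-invariant decomposition $\mathbb V\otimes\wedge^2\mathbb V^*=\partial(\mathfrak g\otimes\mathbb V^* )\oplus\mathcal D$, a connection on $P$ is a $\mathcal D$-connection if its torsion function $P\to\mathbb V\otimes\wedge^2\mathbb V^*$ has values in $\mathcal D$. *)

(* Defs.v *)
From HB Require Import structures.
From mathcomp Require Import all_boot all_order all_algebra all_field.
From mathcomp Require Import all_classical all_reals all_analysis.

Set Implicit Arguments.
Unset Strict Implicit.
Unset Printing Implicit Defensive.

Import Order.TTheory GRing.Theory Num.Theory.
Import numFieldNormedType.Exports.

Local Open Scope classical_set_scope.
Local Open Scope ring_scope.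

(* C^r and C^oo functions on an open set U. On a finite-dimensional V this is
   the usual notion: all iterated directional derivatives exist and are
   continuous on U. The values of f outside U are irrelevant. *)
Fixpoint Ck (R : realType) (V W : normedModType R) (r : nat) (U : set V)
    (f : V -> W) : Prop :=
  (forall x, U x -> {for x, continuous f}) /\
  if r is r'.+1 then
    forall v : V, (forall x, U x -> derivable f x v) /\ Ck r' U ('D_v f)
  else True.

Definition smooth_on (R : realType) (V W : normedModType R) (U : set V)
    (f : V -> W) : Prop := forall r, Ck r U f.

(* The Clifford algebra Cl(s,t) and its regular representation.
   The generators are e_0, ..., e_(s+t-1): the first s square to 1 (the J_j),
   the last t square to -1 (the I_i). *)
Record clifford (R : realType) (s t : nat) (O : falgType R)
    (e : 'I_(s + t) -> O) : Prop := Clifford {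
  clifford_sqr : forall i, e i * e i = if (i < s)%N then 1 else -1;
  clifford_anti : forall i j, i != j -> e i * e j = - (e j * e i);
  clifford_gen : agenv <<codom e>> = fullv;
  clifford_dim : \dim {:O} = (2 ^ (s + t))%N }.

Section CliffordGroup.
Variables (R : realType) (p : nat) (O : falgType R) (e : 'I_p -> O).

(* The standard basis, indexed by binary expansion: the j-th element is the
   increasing product of the e_i over the digits i of j that are equal to 1. *)
Definition std_basis : (2 ^ p).-tuple O :=
  [tuple \prod_(i < p | odd (j %/ 2 ^ i)) e i | j < 2 ^ p].

(* Left multiplication by a, in the standard basis. *)
Definition lreg (a : O) : 'M[R]_(2 ^ p) :=
  \matrix_(i, j) coord std_basis i (a * tnth std_basis j).

Variable m : nat.

(* R^(k * m) is identified with (R^k)^m = 'M_(k, m) (one column per block) by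
   X |-> (mxvec X)^T; block a then acts as X |-> lreg a *m X. *)
Definition block (a : O) : 'M[R]_(2 ^ p * m) := (lin_mulmx (lreg a))^T.

Lemma blockE a (X : 'M[R]_(2 ^ p, m)) :
  block a *m (mxvec X)^T = (mxvec (lreg a *m X))^T.
Proof. by rewrite -trmx_mul mul_vec_lin. Qed.

Definition GLmO : set 'M[R]_(2 ^ p * m) :=
  [set B | B \in unitmx /\ forall i, B *m block (e i) = block (e i) *m B].

Definition GL1O : set 'M[R]_(2 ^ p * m) :=
  [set B | exists2 a : O, a \is a GRing.unit & B = block a].

Definition cliffG : set 'M[R]_(2 ^ p * m) :=
  [set g | exists B C, [/\ GLmO B, GL1O C & g = B *m C]].

(* <F_1, ..., F_k> as a space of endomorphisms of R^(k * m). *)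
Definition cliffA : set 'M[R]_(2 ^ p * m) := range block.

End CliffordGroup.

Arguments GLmO {R p O} e m _.
Arguments GL1O {R p O} e m _.
Arguments cliffG {R p O} e m _.
Arguments cliffA {R p O} e m _.

Section LinearAlgebra.
Variables (R : realType) (n : nat).
Local Notation V := 'cV[R]_n.

(* V^* (x) End V = V (x) V^* (x) V^*; the value at (X, Y) is T X *m Y. *)
Definition tens := 'Hom(V, 'M[R]_n).

(* The Lie algebra of a group of matrices, as its tangent space at 1. *)
Definition lie (G : set 'M[R]_n) : set 'M[R]_n :=
  [set A | exists (W : set R) (c : R -> 'M[R]_n),
    [/\ open W, W 0, smooth_on W c, forall h, W h -> G (c h) & c 0 = 1%:M]
    /\ A = derive1 c 0].

(* The natural action of GL(V), used both for G-modules and for changing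
   coordinates: (g . T)(X, Y) = g (T (g^-1 X) (g^-1 Y)). *)
Definition tens_act (g : 'M[R]_n) (T : tens) : tens :=
  linfun (fun X : V => g *m T (invmx g *m X) *m invmx g).

Lemma tens_actE g T X : tens_act g T X = g *m T (invmx g *m X) *m invmx g.
Proof.
pose f (X : V) := g *m T (invmx g *m X) *m invmx g.
have fl : linear f.
  move=> a x y; rewrite /f mulmxDr -scalemxAr linearP.
  by rewrite /= mulmxDr -scalemxAr mulmxDl -scalemxAl.
pose fL := HB.pack_for {linear V -> 'M[R]_n} f
  (GRing.isLinear.Build _ _ _ _ f fl).
exact: (lfunE fL).
Qed.

(* The Spencer operator; see spencerE. *)
Definition spencer (T : tens) : tens :=
  linfun (fun X : V => T X - \matrix_(i, j) (T (delta_mx j 0) *m X) i 0).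

Lemma spencerE T X Y : spencer T X *m Y = T X *m Y - T Y *m X.
Proof.
pose f (X : V) := T X - \matrix_(i, j) (T (delta_mx j 0) *m X) i 0.
have fl : linear f.
  move=> a x y; rewrite /f linearP scalerBr addrACA -opprD; congr (_ - _).
  apply/matrixP => i j; rewrite mxE mulmxDr -scalemxAr mxE.
  by rewrite [in LHS]mxE [in RHS]mxE [X in _ = X + _]mxE
    [X in _ = _ * X + _]mxE [X in _ = _ + X]mxE.
pose fL := HB.pack_for {linear V -> 'M[R]_n} f
  (GRing.isLinear.Build _ _ _ _ f fl).
rewrite [spencer T X](lfunE fL) /= /f mulmxBl; congr (_ - _).
have {2}-> : Y = \sum_j Y j 0 *: delta_mx j 0.
  by rewrite [LHS]matrix_sum_delta; apply: eq_bigr => j _; rewrite big_ord1.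
apply/matrixP => i k; rewrite (ord1 k) linear_sum mulmx_suml summxE mxE.
by apply: eq_bigr => j _; rewrite linearZ /= -scalemxAl !mxE mulrC.
Qed.

(* V (x) /\^2 V^* *)
Definition alternating (T : tens) : Prop :=
  forall X Y, T X *m Y = - (T Y *m X).

(* Hom(V, g) *)
Definition valued_in (g : set 'M[R]_n) (T : tens) : Prop := forall X, g (T X).

(* D is a G-invariant complement of the image of the Spencer operator. *)
Record invariant_complement (G : set 'M[R]_n) (D : {vspace tens}) : Prop := {
  ic_alt : forall T, T \in D -> alternating T;
  ic_inv : forall g T, G g -> T \in D -> tens_act g T \in D;
  ic_sum : forall T, alternating T ->
    exists B d, [/\ valued_in (lie G) B, d \in D & T = spencer B + d];
  ic_direct : forall B, valued_in (lie G) B -> spencer B \in D ->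
    spencer B = 0 }.

End LinearAlgebra.

Record chart (R : realType) (n : nat) (M : topologicalType) := Chart {
  cdom : set M;
  ccod : set 'cV[R]_n;
  cmap : M -> 'cV[R]_n;
  cinv : 'cV[R]_n -> M;
  cdom_open : open cdom;
  ccod_open : open ccod;
  cmap_cod : forall x, cdom x -> ccod (cmap x);
  cinv_dom : forall y, ccod y -> cdom (cinv y);
  cmapK : forall x, cdom x -> cinv (cmap x) = x;
  cinvK : forall y, ccod y -> cmap (cinv y) = y;
  cmap_cont : forall x, cdom x -> {for x, continuous cmap};
  cinv_cont : forall y, ccod y -> {for y, continuous cinv} }.

Definition overlap (R : realType) (n : nat) (M : topologicalType)
    (a b : chart R n M) : set 'cV[R]_n :=
  [set y | ccod a y /\ cdom b (cinv a y)].

Definition transition (R : realType) (n : nat) (M : topologicalType)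
    (a b : chart R n M) (y : 'cV[R]_n) : 'cV[R]_n := cmap b (cinv a y).

Record manifold (R : realType) (n : nat) := Manifold {
  carrier :> topologicalType;
  manifold_hausdorff : hausdorff_space carrier;
  manifold_countable : @second_countable carrier;
  index : Type;
  atlas : index -> chart R n carrier;
  atlas_cover : forall x, exists a, cdom (atlas a) x;
  atlas_smooth : forall a b,
    smooth_on (overlap (atlas a) (atlas b)) (transition (atlas a) (atlas b)) }.

(* Geometric objects are given by their components in all the charts of the
   atlas, as functions of the coordinates y in the codomain of the chart,
   together with the transformation law on overlaps. Values outside of the
   codomain of the chart are irrelevant. *)
Section Geometry.
Variables (R : realType) (n : nat) (M : manifold R n).
Local Notation V := 'cV[R]_n.
Local Notation dom a := (cdom (atlas (m := M) a)).
Local Notation cod a := (ccod (atlas (m := M) a)).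
Local Notation phi a := (cmap (atlas (m := M) a)).
Local Notation lap a b := (overlap (atlas (m := M) a) (atlas b)).
Local Notation tr a b := (transition (atlas (m := M) a) (atlas b)).

Definition jac (a b : index M) (y : V) : 'M[R]_n :=
  \matrix_(i, j) ('D_(delta_mx j 0) (tr a b) y) i 0.

(* A reduction of the frame bundle to G. A frame u : V -> T_xM is given in a
   chart by the matrix whose columns are the components of the frame. *)
Record Gstructure (G : set 'M[R]_n) := GStructure {
  frames : index M -> V -> set 'M[R]_n;
  frames_orbit : forall a y, cod a y ->
    exists2 u, u \in unitmx & frames a y = [set u *m g | g in G];
  frames_smooth : forall a y, cod a y ->
    exists (W : set V) (u : V -> 'M[R]_n),
      [/\ open W, W y, W `<=` cod a, smooth_on W u &
          forall z, W z -> frames a z (u z)];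
  frames_chart : forall a b y, lap a b y ->
    frames b (tr a b y) = [set jac a b y *m u | u in frames a y] }.

(* Christoffel symbols: nabla_X Y = 'D_X Y + Gamma a y X *m Y in the chart a.
   Tensor fields of type T^*M (x) T^*M (x) TM are also given this way. *)
Definition tens_field := index M -> V -> tens R n.

Definition smooth_field (T : tens_field) : Prop :=
  forall a X, smooth_on (cod a) (fun y => T a y X).

(* Affine transformation law, from nabla_(J X) (J Y) = J (nabla_X Y). *)
Definition is_connection (Gamma : tens_field) : Prop :=
  smooth_field Gamma /\
  forall a b y, lap a b y -> forall X : V,
    Gamma b (tr a b y) (jac a b y *m X) *m jac a b y =
    jac a b y *m Gamma a y X - 'D_X (jac a b) y.

Definition is_tensor (S : tens_field) : Prop :=
  smooth_field S /\
  forall a b y, lap a b y -> S b (tr a b y) = tens_act (jac a b y) (S a y).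

(* A smooth vector subbundle, with typical fibre F, of the bundle
   T^*M (x) T^*M (x) TM. *)
Record tens_bundle (F : vectType R) := TensBundle {
  fiber : index M -> V -> {vspace tens R n};
  fiber_trivial : forall a y, cod a y ->
    exists (W : set V) (f : V -> 'Hom(F, tens R n)),
      [/\ open W, W y, W `<=` cod a,
          forall l X, smooth_on W (fun z => f z l X) &
          forall z, W z -> lker (f z) = 0%VS /\ limg (f z) = fiber a z];
  fiber_chart : forall a b y, lap a b y -> forall T,
    (tens_act (jac a b y) T \in fiber b (tr a b y)) = (T \in fiber a y) }.

Definition section_of F (E : tens_bundle F) (S : tens_field) : Prop :=
  is_tensor S /\ forall a y, cod a y -> S a y \in fiber E a y.

Section Structure.
Variables (G : set 'M[R]_n) (P : Gstructure G).

(* A linear connection is a connection on P when its connection form, pulled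
   back by any smooth local section u of P, has values in the Lie algebra. *)
Definition connection_on (Gamma : tens_field) : Prop :=
  is_connection Gamma /\
  forall a (W : set V) (u : V -> 'M[R]_n),
    open W -> W `<=` cod a -> smooth_on W u ->
    (forall z, W z -> frames P a z (u z)) ->
    forall z, W z -> forall X : V,
      lie G (invmx (u z) *m ('D_X u z + Gamma a z X *m u z)).

(* In a chart the torsion is spencer (Gamma a y); the torsion function takes
   the frame u to the components of the torsion in u. *)
Definition torsion_function (Gamma : tens_field) a y (u : 'M[R]_n) : tens R n :=
  tens_act (invmx u) (spencer (Gamma a y)).

Definition D_connection (D : {vspace tens R n}) (Gamma : tens_field) : Prop :=
  connection_on Gamma /\
  forall a y u, cod a y -> frames P a y u ->
    torsion_function Gamma a y u \in D.

(* A0 is the space of endomorphisms of V which is the model of A. *)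
Variable A0 : set 'M[R]_n.

Definition Afiber (a : index M) (y : V) : set 'M[R]_n :=
  [set F | exists u B, [/\ frames P a y u, A0 B & F = u *m B *m invmx u]].

Definition preserves (Gamma : tens_field) : Prop :=
  forall a (W : set V) (F : V -> 'M[R]_n),
    open W -> W `<=` cod a -> smooth_on W F ->
    (forall z, W z -> Afiber a z (F z)) ->
    forall z, W z -> forall X : V,
      Afiber a z ('D_X F z + Gamma a z X *m F z - F z *m Gamma a z X).

Definition smooth_curve (c : R -> M) : Prop :=
  continuous c /\ forall a, smooth_on (c @^-1` dom a) (phi a \o c).

Definition planar (Gamma : tens_field) (c : R -> M) : Prop :=
  forall a h, dom a (c h) ->
    let y := phi a \o c in
    exists2 F, Afiber a (y h) F &
      derive1n 2 y h + Gamma a (y h) (derive1 y h) *m derive1 y h =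
        F *m derive1 y h.

Definition same_planar_curves (Gamma Gamma' : tens_field) : Prop :=
  forall c, smooth_curve c -> (planar Gamma c <-> planar Gamma' c).

End Structure.
End Geometry.

(* Main.v *)
Require Import Defs.
From HB Require Import structures.
From mathcomp Require Import all_boot all_order all_algebra all_field.
From mathcomp Require Import all_classical all_reals all_analysis.
From mathcomp Require Import ring lra zify.

(* Let O = Cl(s, t), V = O^m, and let g = gl(m, O) + O be the Lie algebra of G.
   If nabla and nabla + S are D-connections, then in every frame S is a
   g-valued tensor, symmetric because D meets the image of the Spencer operator
   trivially. It satisfies S(X, X) \in O X: through every point and direction
   there is a geodesic of nabla, which becomes a curve defined on all of R after
   a reparametrization that keeps it A-planar, and one compares the equations
   of the two connections along it.

   Such tensors are exactly S_nu(X, Y) = lam(X) Y + lam(Y) X, where lam is the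
   O-linear form V -> O with coefficients nu \in O^m. Subtracting a suitable
   S_nu one may assume S(eps_q, eps_q) = 0 for the standard basis eps_q of O^m.
   On O eps_q, S reads (x, y) |-> alpha(x) y + y beta(x), and its symmetry,
   compared on the products F_i F_k F_j of basis elements, forces it to vanish.
   For p != q and x, y units, S(x eps_p, y eps_q) is half of
   f (x eps_p + y eps_q) for some f \in O; changing y into -y gives f x = - f' x
   and f y = f' y for some f', hence f = 0.

   Conversely, S_nu does not change the torsion nor the planar curves. Every
   connection on P preserves A, because g normalizes O. *)

Set Implicit Arguments.
Unset Strict Implicit.
Unset Printing Implicit Defensive.
Import Order.TTheory GRing.Theory Num.Theory.
Import numFieldNormedType.Exports.
Local Open Scope classical_set_scope.
Local Open Scope ring_scope.

(** * Differentiable and smooth functions in finite dimension *)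

(** The Lie algebra is given as the set of velocities at 1 of curves in G, so gl(m, O) + O must
    first be recognized in it: differentiating g F g^-1 \in O gives [A, O] \subset O for a velocity
    A, and averaging over the standard basis then splits off the part of A that lies in O. In S(X,
    X) = a X the element a may depend on X in any way, so nothing can be differentiated or compared
    linearly in a; only polarization and signs are available. On one block the sign in F_j F_k F_i =
    +- F_i F_k F_j decides what symmetry says about the coefficients of alpha and beta: a plus sign
    relates their sums, a minus sign their differences. The sums are killed by the normalization at
    the unit, the differences by a triangle of indices any two of which give a minus sign. Planarity
    is tested on curves R -> M only, while geodesics exist locally; this is why a reparametrization
    is forced. Smoothness is stated through iterated directional derivatives, from which
    differentiability, the chain rule and local solutions of differential equations are derived. *)

Section Increment.
Variable R : realType.

(** Both derivatives have the same difference quotients. This lets theorems about one real variable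
    be applied along a line. *)
Lemma is_derive_line (V W : normedModType R) (g : V -> W) (z v : V) (s : R) :
  is_derive s 1 (fun s => g (s *: v + z)) ('D_v g (s *: v + z)) <->
  derivable g (s *: v + z) v.
Proof.
have E : (fun h : R => h^-1 *: (((fun s => g (s *: v + z)) \o shift s) (h *: 1) -
    g (s *: v + z))) =
  (fun h : R => h^-1 *: ((g \o shift (s *: v + z)) (h *: v) - g (s *: v + z))).
  by apply: funext => h /=; rewrite [_%:A]mulr1 scalerDl addrA.
split; first by case; rewrite /derivable E.
by move=> gd; split; rewrite /derivable /derive E.
Qed.

(** The conditions [|s| <= |a|] and [0 <= s * a] describe the segment between 0 and [a] whatever the
    sign of [a]. *)
Lemma mean_value_line (V : normedModType R) (g : V -> R) (z v : V) (a : R) :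
  (forall s, `|s| <= `|a| -> 0 <= s * a -> derivable g (s *: v + z) v) ->
  exists c, [/\ `|c| <= `|a|, 0 <= c * a &
    g (a *: v + z) - g z = a * 'D_v g (c *: v + z)].
Proof.
move=> gd; pose f s := g (s *: v + z).
have fd s : `|s| <= `|a| -> 0 <= s * a -> is_derive s 1 f ('D_v g (s *: v + z)).
  by move=> s1 s2; apply/is_derive_line/gd.
have fc s : `|s| <= `|a| -> 0 <= s * a -> {for s, continuous f}.
  move=> s1 s2; have [fs _] := fd s s1 s2.
  by apply/differentiable_continuous/derivable1_diffP.
have [a0|a0] := leP 0 a.
  have seg s : s \in `[0, a] -> `|s| <= `|a| /\ 0 <= s * a.
    by rewrite in_itv /= => /andP[s0 sa]; rewrite !ger0_norm// mulr_ge0.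
  have [|||c ca E] := @MVT_segment R f (fun s => 'D_v g (s *: v + z)) 0 a => //.
  - by move=> x xa; have [] := seg x (subset_itv_oo_cc xa); apply: fd.
  - apply: continuous_in_subspaceT => x /set_mem /= xa.
    by have [] := seg x xa; apply: fc.
  have [c1 c2] := seg c ca; exists c; split => //.
  by move: E; rewrite /f scale0r add0r subr0 mulrC.
have seg s : s \in `[a, 0] -> `|s| <= `|a| /\ 0 <= s * a.
  rewrite in_itv /= => /andP[s0 sa]; rewrite !ler0_norm ?(ltW a0)// lerN2.
  by rewrite mulr_le0// ltW.
have [|||c ca E] := @MVT_segment R f (fun s => 'D_v g (s *: v + z)) a 0 => //.
- exact: ltW.
- by move=> x xa; have [] := seg x (subset_itv_oo_cc xa); apply: fd.
- apply: continuous_in_subspaceT => x /set_mem /= xa.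
  by have [] := seg x xa; apply: fc.
have [c1 c2] := seg c ca; exists c; split => //.
by move: E; rewrite /f scale0r add0r sub0r mulrN mulrC -opprB => /oppr_inj.
Qed.

Lemma mx_norm_ltP (m n : nat) (x : 'M[R]_(m, n)) (d : R) : 0 < d ->
  `|x| < d <-> forall i j, `|x i j| < d.
Proof.
move=> d0; rewrite [`|x|]mx_normrE; split=> [xd i j|xd].
  apply: le_lt_trans xd.
  exact: (le_bigmax _ (fun ij : 'I_m * 'I_n => `|x ij.1 ij.2|) (i, j)).
by apply/bigmax_ltP; split => // -[i j] _; apply: xd.
Qed.

Lemma mx_norm_leP (m n : nat) (x : 'M[R]_(m, n)) (d : R) : 0 <= d ->
  `|x| <= d <-> forall i j, `|x i j| <= d.
Proof.
move=> d0; rewrite [`|x|]mx_normrE; split=> [xd i j|xd].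
  apply: le_trans xd.
  exact: (le_bigmax _ (fun ij : 'I_m * 'I_n => `|x ij.1 ij.2|) (i, j)).
by apply/bigmax_leP; split => // -[i j] _; apply: xd.
Qed.

Lemma mx_coord_le (m n : nat) (x : 'M[R]_(m, n)) i j : `|x i j| <= `|x|.
Proof. exact: (mx_norm_leP x (normr_ge0 x)).1. Qed.

(* Changing one coordinate at a time, the increment of g is a telescoping sum
   of increments along the axes, to which the mean value theorem applies. *)
Lemma increment_bound (n : nat) (g : 'cV[R]_n -> R) (x : 'cV[R]_n) (r eta : R)
    (d : 'I_n -> R) :
  (forall z k, `|z - x| < r -> derivable g z (delta_mx k 0) /\
     `|'D_(delta_mx k 0) g z - d k| <= eta) ->
  forall y y', `|y - x| < r -> `|y' - x| < r ->
  `|g y' - g y - \sum_k (y' k 0 - y k 0) * d k|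
     <= eta * \sum_k `|y' k 0 - y k 0|.
Proof.
move=> gd y y' yr yr'.
have r0 : 0 < r by apply: le_lt_trans yr.
pose w l := \col_i (if (i < l)%N then y' i 0 else y i 0) : 'cV[R]_n.
pose D k := y' k 0 - y k 0.
suff H l : (l <= n)%N ->
    `|g (w l) - g y - \sum_(k < n | (k < l)%N) D k * d k|
      <= eta * \sum_(k < n | (k < l)%N) `|D k|.
  have := H n (leqnn n); have -> : w n = y'.
    by apply/matrixP => i j; rewrite mxE ltn_ord (ord1 j).
  by rewrite (eq_bigl xpredT) 1?[X in _ <= _ * X](eq_bigl xpredT)// => k;
    rewrite ltn_ord.
elim: l => [|l IH] ln.
  rewrite !big_pred0 // mulr0 subr0 (_ : w 0 = y) ?subrr ?normr0 //.
  by apply/matrixP => i j; rewrite mxE (ord1 j).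
pose k0 := Ordinal ln.
have split_sum (F : 'I_n -> R) : \sum_(k < n | (k < l.+1)%N) F k =
    F k0 + \sum_(k < n | (k < l)%N) F k.
  rewrite (bigD1 k0) //=; congr (_ + _); apply: eq_bigl => k.
  rewrite ltnS ltn_neqAle -(inj_eq val_inj) /=.
  by rewrite andbC.
rewrite !split_sum.
have wS : w l.+1 = D k0 *: delta_mx k0 0 + w l.
  apply/matrixP => i j; rewrite !mxE (ord1 j) eqxx andbT ltnS.
  have [->|ik] := eqVneq i k0; first by rewrite leqnn ltnn mulr1 /D subrK.
  rewrite mulr0 add0r leq_eqVlt.
  by move: ik; rewrite -(inj_eq val_inj) /= => /negPf->.
(* The norm is the sup norm, and each coordinate of the intermediate point lies between those of [y]
   and [y'], so the point stays in the ball. *)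
have win s : `|s| <= `|D k0| -> 0 <= s * D k0 ->
    `|s *: delta_mx k0 0 + w l - x| < r.
  move=> s1 s2; apply/mx_norm_ltP => // i j; rewrite !mxE (ord1 j) eqxx andbT.
  have [->|ik] := eqVneq i k0.
    have := (mx_norm_ltP (y - x) r0).1 yr k0 0.
    have := (mx_norm_ltP (y' - x) r0).1 yr' k0 0.
    rewrite !mxE /= ltnn mulr1; move: s1 s2; rewrite /D.
    move: (y k0 0) (y' k0 0) (x k0 0) => a b c.
    have [ba|ba] := leP 0 (b - a).
      rewrite (ger0_norm ba) => s1.
      have [ab0|bn0] := eqVneq (b - a) 0.
        move=> _; move: s1; rewrite ab0 ler_norml !ltr_norml.
        by move=> /andP[? ?] /andP[? ?] /andP[? ?]; apply/andP; split; lra.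
      have bp : 0 < b - a by rewrite lt_def bn0 ba.
      rewrite pmulr_lge0 // => s0; move: s1; rewrite ler_norml !ltr_norml.
      by move=> /andP[? ?] /andP[? ?] /andP[? ?]; apply/andP; split; lra.
    rewrite (ltr0_norm ba) => s1; rewrite nmulr_lge0 // => s0; move: s1.
    rewrite ler_norml !ltr_norml.
    by move=> /andP[? ?] /andP[? ?] /andP[? ?]; apply/andP; split; lra.
  rewrite mulr0 add0r; case: ifP => _.
    by have := (mx_norm_ltP (y' - x) r0).1 yr' i 0; rewrite !mxE.
  by have := (mx_norm_ltP (y - x) r0).1 yr i 0; rewrite !mxE.
have [s s1 s2|c [c1 c2 gE]] := @mean_value_line _ g (w l) (delta_mx k0 0) (D k0).
  by have [] := gd _ k0 (win s s1 s2).
have [_ cd] := gd _ k0 (win c c1 c2).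
have -> : g (w l.+1) - g y - (D k0 * d k0 + \sum_(k < n | (k < l)%N) D k * d k) =
  D k0 * ('D_(delta_mx k0 0) g (c *: delta_mx k0 0 + w l) - d k0) +
  (g (w l) - g y - \sum_(k < n | (k < l)%N) D k * d k).
  by rewrite mulrBr -gE -wS; ring.
rewrite [leRHS]mulrDr (le_trans (ler_normD _ _)) // lerD //; last exact: IH (ltnW ln).
by rewrite normrM mulrC ler_wpM2r.
Qed.

End Increment.

(** * Closure properties of C^r maps *)

Section Smooth.
Variable R : realType.

Section General.
Variables V W : normedModType R.
Implicit Types (U : set V) (f g : V -> W).

Lemma Ck_continuous r U f x : Ck r U f -> U x -> {for x, continuous f}.
Proof. by case: r => [|r] /= [+ _]; apply. Qed.

Lemma Ck_derivable r U f x v : Ck r.+1 U f -> U x -> derivable f x v.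
Proof. by move=> /= [_ /(_ v)[+ _]]; apply. Qed.

Lemma Ck_derive r U f v : Ck r.+1 U f -> Ck r U ('D_v f).
Proof. by move=> /= [_ /(_ v)[]]. Qed.

Lemma Ck_pred r U f : Ck r.+1 U f -> Ck r U f.
Proof.
elim: r f => [|r IH] f fr; first by split=> // x; apply: Ck_continuous fr.
split=> [x|v]; first exact: Ck_continuous fr.
by split=> [x|]; [exact: Ck_derivable fr|exact/IH/Ck_derive].
Qed.

Lemma Ck_subset r U U' f : U' `<=` U -> Ck r U f -> Ck r U' f.
Proof.
move=> U'U; elim: r f => [|r IH] f fr.
  by split=> // x /U'U; apply: Ck_continuous fr.
split=> [x /U'U|v]; first exact: Ck_continuous fr.
by split=> [x /U'U|]; [exact: Ck_derivable fr|exact/IH/Ck_derive].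
Qed.

Lemma open_near_eq U f g x : open U -> U x -> (forall x, U x -> f x = g x) ->
  {near x, f =1 g}.
Proof.
move=> Uo Ux fg.
have := open_nbhs_nbhs (conj Uo Ux); apply: filterS => y; exact: fg.
Qed.

Lemma continuous_at_near_eq f g x : {near x, f =1 g} ->
  {for x, continuous f} -> {for x, continuous g}.
Proof.
move=> fg fx; change (g @ x --> g x); rewrite -(nbhs_singleton fg).
by apply: cvg_trans fx; apply: near_eq_cvg.
Qed.

(** Openness turns agreement on U into agreement near each point, which is all that a derivative
    sees. Each formula for a derivative valid on U can therefore be fed back into the induction on
    r. *)
Lemma eq_Ck r U f g : open U -> (forall x, U x -> f x = g x) ->
  Ck r U f -> Ck r U g.
Proof.
move=> Uo; elim: r f g => [|r IH] f g fg fr.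
  split=> // x Ux; apply: (continuous_at_near_eq (open_near_eq Uo Ux fg)).
  exact: Ck_continuous fr Ux.
split=> [x Ux|v].
  apply: (continuous_at_near_eq (open_near_eq Uo Ux fg)).
  exact: Ck_continuous fr Ux.
split=> [x Ux|].
  apply: (near_eq_derivable (open_near_eq Uo Ux fg)).
  exact: Ck_derivable fr Ux.
apply: (IH ('D_v f)); last exact: Ck_derive.
by move=> x Ux; apply: near_eq_derive; exact: (open_near_eq Uo Ux fg).
Qed.

Lemma Ck_cst r U (c : W) : Ck r U (cst c).
Proof.
elim: r c => [|r IH] c; first by split=> // x _; exact: cst_continuous.
split=> [x _|v]; first exact: cst_continuous.
split=> [x _|]; first exact: derivable_cst.
by have -> : 'D_v (cst c) = cst (0 : W) by apply: funext => x; exact: derive_cst.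
Qed.

Lemma CkD r U f g : open U -> Ck r U f -> Ck r U g ->
  Ck r U (fun x => f x + g x).
Proof.
move=> Uo; elim: r f g => [|r IH] f g fr gr.
  by split=> // x Ux; apply: cvgD; [exact: Ck_continuous fr Ux|exact: Ck_continuous gr Ux].
split=> [x Ux|v].
  by apply: cvgD; [exact: Ck_continuous fr Ux|exact: Ck_continuous gr Ux].
split=> [x Ux|].
  by apply: derivableD; [exact: Ck_derivable fr Ux|exact: Ck_derivable gr Ux].
apply: (eq_Ck Uo _ (IH _ _ (Ck_derive v fr) (Ck_derive v gr))) => x Ux.
by rewrite deriveD; [|exact: Ck_derivable fr Ux|exact: Ck_derivable gr Ux].
Qed.

Lemma CkN r U f : open U -> Ck r U f -> Ck r U (fun x => - f x).
Proof.
move=> Uo; elim: r f => [|r IH] f fr.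
  by split=> // x Ux; apply: cvgN; exact: Ck_continuous fr Ux.
split=> [x Ux|v]; first by apply: cvgN; exact: Ck_continuous fr Ux.
split=> [x Ux|]; first by apply: derivableN; exact: Ck_derivable fr Ux.
apply: (eq_Ck Uo _ (IH _ (Ck_derive v fr))) => x Ux.
by rewrite deriveN //; exact: Ck_derivable fr Ux.
Qed.

Lemma CkB r U f g : open U -> Ck r U f -> Ck r U g ->
  Ck r U (fun x => f x - g x).
Proof. by move=> Uo fr gr; apply: CkD => //; apply: CkN. Qed.

Lemma Ck_sum r U (I : Type) (s : seq I) (P : pred I) (F : I -> V -> W) :
  open U -> (forall i, Ck r U (F i)) ->
  Ck r U (fun x => \sum_(i <- s | P i) F i x).
Proof.
move=> Uo Fr; elim: s => [|i s IH].
  by apply: (eq_Ck Uo _ (Ck_cst r U 0)) => x _; rewrite big_nil.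
case: (boolP (P i)) => Pi; last first.
  by apply: (eq_Ck Uo _ IH) => x _; rewrite big_cons (negPf Pi).
by apply: (eq_Ck Uo _ (CkD Uo (Fr i) IH)) => x _; rewrite big_cons Pi.
Qed.

End General.

Section Scalar.
Variable V : normedModType R.
Implicit Types (U : set V) (f g : V -> R).

Lemma CkM r U f g : open U -> Ck r U f -> Ck r U g ->
  Ck r U (fun x => f x * g x).
Proof.
move=> Uo; elim: r f g => [|r IH] f g fr gr.
  by split=> // x Ux; apply: cvgM; [exact: Ck_continuous fr Ux|exact: Ck_continuous gr Ux].
split=> [x Ux|v].
  by apply: cvgM; [exact: Ck_continuous fr Ux|exact: Ck_continuous gr Ux].
split=> [x Ux|].
  by apply: derivableM; [exact: Ck_derivable fr Ux|exact: Ck_derivable gr Ux].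
apply: (eq_Ck Uo _ (CkD Uo (IH _ _ (Ck_pred fr) (Ck_derive v gr))
  (IH _ _ (Ck_pred gr) (Ck_derive v fr)))) => x Ux.
by rewrite deriveM; [|exact: Ck_derivable fr Ux|exact: Ck_derivable gr Ux].
Qed.

Lemma Ck_prod r U (I : Type) (s : seq I) (P : pred I) (F : I -> V -> R) :
  open U -> (forall i, Ck r U (F i)) ->
  Ck r U (fun x => \prod_(i <- s | P i) F i x).
Proof.
move=> Uo Fr; elim: s => [|i s IH].
  by apply: (eq_Ck Uo _ (@Ck_cst V R r U 1)) => x _; rewrite big_nil.
case: (boolP (P i)) => Pi; last first.
  by apply: (eq_Ck Uo _ IH) => x _; rewrite big_cons (negPf Pi).
by apply: (eq_Ck Uo _ (CkM Uo (Fr i) IH)) => x _; rewrite big_cons Pi.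
Qed.

Lemma CkV r U f : open U -> (forall x, U x -> f x != 0) -> Ck r U f ->
  Ck r U (fun x => (f x)^-1).
Proof.
move=> Uo f0; elim: r => [|r IH] fr.
  by split=> // x Ux; apply: cvgV; [exact: f0|exact: Ck_continuous fr Ux].
split=> [x Ux|v].
  by apply: cvgV; [exact: f0|exact: Ck_continuous fr Ux].
split=> [x Ux|].
  by apply: derivableV; [exact: f0|exact: Ck_derivable fr Ux].
have fVr := IH (Ck_pred fr).
apply: (eq_Ck Uo _ (CkN Uo (CkM Uo (CkM Uo fVr fVr) (Ck_derive v fr)))) => x Ux.
rewrite deriveV; [|exact: f0|exact: Ck_derivable fr Ux].
by rewrite /= -invfM -expr2 scaleNr.
Qed.

End Scalar.

Section Matrix.
Variables (V : normedModType R) (m n : nat).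
Implicit Types (U : set V) (M : V -> 'M[R]_(m, n)).

Lemma continuous_mxP M x : {for x, continuous M} <->
  forall i j, {for x, continuous (fun x => M x i j)}.
Proof.
split=> [Mx i j|Mx].
  apply: (@continuous_comp _ _ _ M (fun A : 'M[R]_(m, n) => A i j)) => //.
  exact: coord_continuous.
apply/cvgrPdist_lt => e e0.
have : \forall y \near x, forall ij, `|M x ij.1 ij.2 - M y ij.1 ij.2| < e.
  by apply: filter_forall => -[i j]; have /cvgrPdist_lt/(_ _ e0) := Mx i j.
apply: filterS => y My; apply/mx_norm_ltP => // i j; rewrite !mxE.
exact: (My (i, j)).
Qed.

Lemma Ck_mxP r U M : open U -> Ck r U M <-> forall i j, Ck r U (fun x => M x i j).
Proof.
move=> Uo; elim: r M => [|r IH] M.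
  split=> [Mr i j|Mr]; split=> // x Ux.
    by have /continuous_mxP := Ck_continuous Mr Ux; apply.
  by apply/continuous_mxP => i j; exact: Ck_continuous (Mr i j) Ux.
split=> [Mr i j|Mr]; split=> [x Ux|v].
- by have /continuous_mxP := Ck_continuous Mr Ux; apply.
- split=> [x Ux|]; first by have /derivable_mxP := @Ck_derivable _ _ _ _ _ x v Mr Ux; apply.
  apply: (eq_Ck Uo _ ((IH _).1 (Ck_derive v Mr) i j)) => x Ux.
  by rewrite derive_mx ?mxE //; exact: Ck_derivable Mr Ux.
- by apply/continuous_mxP => i j; exact: Ck_continuous (Mr i j) Ux.
split=> [x Ux|].
  by apply/derivable_mxP => i j; exact: Ck_derivable (Mr i j) Ux.
apply/IH => i j; apply: (eq_Ck Uo _ (Ck_derive v (Mr i j))) => x Ux.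
rewrite derive_mx ?mxE //.
by apply/derivable_mxP => i' j'; exact: Ck_derivable (Mr i' j') Ux.
Qed.

End Matrix.

Lemma Ck_mulmx (V : normedModType R) r (U : set V) (m n p : nat)
    (M : V -> 'M[R]_(m, n)) (N : V -> 'M[R]_(n, p)) : open U ->
  Ck r U M -> Ck r U N -> Ck r U (fun x => M x *m N x).
Proof.
move=> Uo /(Ck_mxP _ _ Uo)Mr /(Ck_mxP _ _ Uo)Nr; apply/Ck_mxP => // i j.
apply: (@eq_Ck _ _ _ _ (fun x => \sum_k M x i k * N x k j)) => // [x _|].
  by rewrite mxE.
by apply: Ck_sum => // k; exact: CkM.
Qed.

Lemma Ck_det (V : normedModType R) r (U : set V) (n : nat) (M : V -> 'M[R]_n) :
  open U -> Ck r U M -> Ck r U (fun x => \det (M x)).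
Proof.
move=> Uo /(Ck_mxP _ _ Uo)Mr; rewrite /determinant.
apply: Ck_sum => // s; apply: CkM => //; first exact: Ck_cst.
by apply: Ck_prod => // i; exact: Mr.
Qed.

Lemma Ck_invmx (V : normedModType R) r (U : set V) (n : nat) (M : V -> 'M[R]_n) :
  open U -> (forall x, U x -> M x \in unitmx) -> Ck r U M ->
  Ck r U (fun x => invmx (M x)).
Proof.
move=> Uo Mu Mr; apply/Ck_mxP => // i j.
apply: (@eq_Ck _ _ _ _ (fun x => (\det (M x))^-1 * cofactor (M x) j i)) => //.
  by move=> x Ux; rewrite /invmx (Mu _ Ux) !mxE.
apply: CkM => //.
  apply: CkV => //; last exact: Ck_det.
  by move=> x /Mu; rewrite unitmxE unitfE.
apply: CkM => //; first exact: Ck_cst.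
apply: Ck_det => //; apply/Ck_mxP => // i' j'.
apply: (@eq_Ck _ _ _ _ (fun x => M x (lift j i') (lift i j'))) => //.
  by move=> x _; rewrite !mxE.
by have /(Ck_mxP _ _ Uo) := Mr; apply.
Qed.

End Smooth.

(** * Differentiability of C^1 maps and the chain rule *)

Section Chain.
Variable R : realType.

Lemma Ck_near_bound (n : nat) (U : set 'cV[R]_n) (g : 'cV[R]_n -> R) x :
  open U -> Ck 1 U g -> U x -> forall eta, 0 < eta ->
  exists2 r, 0 < r & forall z k, `|z - x| < r ->
    [/\ U z, derivable g z (delta_mx k 0) &
        `|'D_(delta_mx k 0) g z - 'D_(delta_mx k 0) g x| <= eta].
Proof.
move=> Uo g1 Ux eta eta0.
have : \forall z \near x, U z /\ forall k : 'I_n,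
    `|'D_(delta_mx k 0) g x - 'D_(delta_mx k 0) g z| < eta.
  near=> z; split; near: z; first exact: open_nbhs_nbhs.
  apply: filter_forall => k.
  have /cvgrPdist_lt := Ck_continuous (Ck_derive (delta_mx k 0) g1) Ux.
  exact.
case/nbhs_ballP => r /= r0 rU; exists r => // z k zr.
have [|Uz gz] := rU z; first by rewrite -ball_normE /= distrC.
split=> //; first exact: Ck_derivable g1 Uz.
by rewrite distrC ltW.
Unshelve. all: by end_near. Qed.

(** Continuity of the partial derivatives makes the error in [increment_bound] at most e |h| near x,
    which is the little-o estimate for the candidate differential [df]. *)
Lemma C1_differentiable (n : nat) (U : set 'cV[R]_n) (g : 'cV[R]_n -> R) x :
  open U -> Ck 1 U g -> U x -> differentiable g x.
Proof.
move=> Uo g1 Ux.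
pose df (h : 'cV[R]_n) := \sum_k h k 0 * 'D_(delta_mx k 0) g x.
have dfl : linear df.
  move=> a u v; rewrite /df scaler_sumr -big_split /=; apply: eq_bigr => k _.
  by rewrite !mxE /= mulrDl -mulrA.
pose dfL := HB.pack_for {linear 'cV[R]_n -> R} df
  (GRing.isLinear.Build _ _ _ _ df dfl).
have dfc : continuous dfL.
  have df0 : Ck 0 setT df.
    apply: Ck_sum => [|k]; first exact: openT.
    apply: CkM; [exact: openT| |exact: Ck_cst].
    by split=> // y _; apply: coord_continuous.
  by move=> y; apply: Ck_continuous df0 _.
have := @diff_unique R 'cV[R]_n R g dfL x dfc.
move=> dE.
(* This is the expansion of g at x up to o(h), the premise of [diff_unique]. *)
have dxf : ltac:(match type of dE with ?A -> _ => exact A end).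
  apply/eqaddoP => e e0.
  (* The error is summed over n coordinates, each at most |h|; [n.+1] in place of n avoids a zero
     denominator. *)
  have [|r r0 gr] := @Ck_near_bound _ _ _ _ Uo g1 Ux (e / n.+1%:R).
    by rewrite divr_gt0.
  near=> h.
  have hr : `|h| < r.
    near: h; apply/nbhs_ballP; exists r => // y.
    by rewrite -ball_normE /= sub0r normrN.
  have xr : `|x - x| < r by rewrite subrr normr0.
  have hxr : `|h + x - x| < r by rewrite addrK.
  have := @increment_bound _ _ g x r (e / n.+1%:R)
    (fun k => 'D_(delta_mx k 0) g x) _ x (h + x) xr hxr.
  move=> /(_ (fun z k zr => let: And3 _ a b := gr z k zr in conj a b)).
  set S := \sum_k _; set T := \sum_k _ => gST.
  have -> : (g \o shift x - (cst (g x) + dfL)) h = g (h + x) - g x - S.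
    rewrite /= -[LHS]/(g (h + x) - (g x + df h)) opprD addrA; congr (_ - _).
    by apply: eq_bigr => k _; rewrite !mxE addrK.
  apply: le_trans gST _.
  have Tn : T <= n.+1%:R * `|h|.
    apply: (@le_trans _ _ (\sum_(k < n) `|h|)).
      by apply: ler_sum => k _; rewrite !mxE addrK mx_coord_le.
    rewrite sumr_const card_ord -[leLHS]mulr_natl.
    by apply: ler_wpM2r => //; rewrite ler_nat.
  apply: (@le_trans _ _ (e / n.+1%:R * (n.+1%:R * `|h|))).
    by apply: ler_wpM2l => //; rewrite divr_ge0 // ltW.
  by rewrite mulrA divfK.
apply/diff_locallyP; rewrite (dE dxf); split => //.
Unshelve. all: by end_near. Qed.

(** On the line through t along w, x becomes a function of one real variable. There derivability
    amounts to differentiability, and the chain rule for differentials applies. *)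
Lemma is_derive_comp (V : normedModType R) (n : nat) (g : 'cV[R]_n -> R)
    (x : V -> 'cV[R]_n) t w :
  differentiable g (x t) -> derivable x t w ->
  is_derive t w (g \o x) (\sum_k 'D_w x t k 0 * 'D_(delta_mx k 0) g (x t)).
Proof.
move=> gd xd; pose f s := x (s *: w + t).
have f0 : f 0 = x t by rewrite /f scale0r add0r.
have [fd fE] : is_derive (0 : R) (1 : R) f ('D_w x t).
  by rewrite -[in 'D_w x t](add0r t) -(scale0r w); apply/is_derive_line;
    rewrite scale0r add0r.
have fdiff : differentiable f 0 by apply/derivable1_diffP.
rewrite -f0 in gd.
have gfd : differentiable (g \o f) 0 by apply: differentiable_comp.
have gfE : 'D_1 (g \o f) 0 = \sum_k 'D_w x t k 0 * 'D_(delta_mx k 0) g (x t).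
  have fE' : 'd f 0 1 = 'D_w x t by rewrite -deriveE.
  rewrite deriveE // diff_comp //= fE'.
  rewrite {1}[X in 'd _ _ X = _]matrix_sum_delta linear_sum.
  apply: eq_bigr => k _; rewrite big_ord1 linearZ /=; congr (_ * _).
  by rewrite -deriveE // f0.
have : is_derive (0 : R) (1 : R) (g \o f) ('D_w (g \o x) (0 *: w + t)).
  apply/is_derive_line; apply/derivable1P; rewrite scale0r add0r.
  by apply/derivable1_diffP.
case=> _; rewrite gfE scale0r add0r => ->; apply: derivableP.
by apply/derivable1P/derivable1_diffP.
Qed.

Lemma Ck_comp (V : normedModType R) (n r : nat) (U : set 'cV[R]_n) (U' : set V)
    (g : 'cV[R]_n -> R) (x : V -> 'cV[R]_n) :
  open U -> open U' -> (forall t, U' t -> U (x t)) ->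
  Ck r U g -> Ck r U' x -> Ck r U' (g \o x).
Proof.
move=> Uo U'o xU; elim: r g => [|r IH] g gr xr.
  split=> // t Ut; apply: continuous_comp.
    exact: Ck_continuous xr Ut.
  by apply: Ck_continuous gr _; apply: xU.
have gx t w : U' t -> is_derive t w (g \o x)
    (\sum_k 'D_w x t k 0 * 'D_(delta_mx k 0) g (x t)).
  move=> Ut; apply: is_derive_comp; last exact: Ck_derivable xr Ut.
  apply: (C1_differentiable Uo _ (xU _ Ut)).
  elim: r {IH xr} gr => // r IHr gr.
  by apply: IHr; apply: Ck_pred.
split=> [t Ut|w].
  apply: continuous_comp; first exact: Ck_continuous xr Ut.
  by apply: Ck_continuous gr _; apply: xU.
split=> [t Ut|]; first by have [] := gx t w Ut.
apply: (@eq_Ck _ _ _ _ _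
  (fun t => \sum_k 'D_w x t k 0 * ('D_(delta_mx k 0) g \o x) t)) => //.
  by move=> t Ut; have [_ ->] := gx t w Ut.
apply: Ck_sum => // k; apply: CkM => //.
  by have /(Ck_mxP _ _ U'o) := Ck_derive w xr; apply.
by apply: IH; [exact: Ck_derive|exact: Ck_pred].
Qed.

Lemma Ck_comp_mx (V : normedModType R) (n p q r : nat) (U : set 'cV[R]_n)
    (U' : set V) (g : 'cV[R]_n -> 'M[R]_(p, q)) (x : V -> 'cV[R]_n) :
  open U -> open U' -> (forall t, U' t -> U (x t)) ->
  Ck r U g -> Ck r U' x -> Ck r U' (g \o x).
Proof.
move=> Uo U'o xU /(Ck_mxP _ _ Uo) gr xr; apply/Ck_mxP => // i j.
exact: (Ck_comp Uo U'o xU (gr i j)).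
Qed.

End Chain.

(** * Ordinary differential equations *)

Section Picard.
Variable R : realType.
Local Notation mu := (@lebesgue_measure R).

Lemma is_derive_coord (V : normedModType R) (m n : nat) (f : V -> 'M[R]_(m, n))
    (t v : V) (d : 'M[R]_(m, n)) i j :
  is_derive t v f d -> is_derive t v (fun x => f x i j) (d i j).
Proof.
case=> fd <-; rewrite derive_mx // mxE; apply: derivableP.
by have /derivable_mxP := fd; apply.
Qed.

Lemma is_derive_mx (V : normedModType R) (m n : nat) (f : V -> 'M[R]_(m, n))
    (t v : V) (d : 'M[R]_(m, n)) :
  (forall i j, is_derive t v (fun x => f x i j) (d i j)) -> is_derive t v f d.
Proof.
move=> fd; have fdv : derivable f t v.
  by apply/derivable_mxP => i j; have [] := fd i j.
split=> //; apply/matrixP => i j; rewrite derive_mx // mxE.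
by have [] := fd i j.
Qed.

Lemma is_derive_continuous (W : normedModType R) (f : R -> W) (t : R) d :
  is_derive t (1 : R) f d -> {for t, continuous f}.
Proof. by case=> fd _; apply/differentiable_continuous/derivable1_diffP. Qed.

(** For the sup norm the scalar mean value theorem can be used entry by entry without loss in the
    constant. *)
Lemma increment_le (m n : nat) (y y' : R -> 'M[R]_(m, n)) (t a C : R)
    (d : 'M[R]_(m, n)) : 0 <= C ->
  (forall s, `|s| <= `|a| -> 0 <= s * a ->
     is_derive (s + t) (1 : R) y (y' (s + t)) /\ `|y' (s + t) - d| <= C) ->
  `|y (a + t) - y t - a *: d| <= C * `|a|.
Proof.
move=> C0 yd; apply/mx_norm_leP => [|i j]; first by rewrite mulr_ge0.
have E (s : R) : s *: (1 : R) + t = s + t by rewrite [_%:A]mulr1.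
have ydi s : `|s| <= `|a| -> 0 <= s * a ->
    is_derive (s + t) (1 : R) (fun t => y t i j) (y' (s + t) i j).
  by move=> s1 s2; apply: is_derive_coord; have [] := yd s s1 s2.
have [s s1 s2|c [c1 c2]] := @mean_value_line R R (fun t => y t i j) t 1 a.
  by rewrite E; have [] := ydi s s1 s2.
rewrite !E; have [_ ->] := ydi c c1 c2 => yE.
rewrite !mxE yE -mulrBr normrM mulrC ler_wpM2r //.
have [_ /mx_norm_leP] := yd c c1 c2.
by move=> /(_ C0 i j); rewrite !mxE.
Qed.

(** A quadratic error bound, unlike a derivative, survives a pointwise limit. The limit of the
    Picard iterates is differentiated in this way. *)
Lemma is_derive_quadratic (W : normedModType R) (f : R -> W) (t : R) (d : W) (K r : R) :
  0 < r -> (forall h, `|h| < r -> `|f (h + t) - f t - h *: d| <= K * `|h| ^+ 2) ->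
  is_derive t (1 : R) f d.
Proof.
move=> r0 fq; have fd : (fun h : R => h^-1 *: ((f \o shift t) (h *: 1) - f t)) @ 0^' --> d.
  apply/cvgrPdist_le => e e0; near=> h.
  have hr : `|h| < r by near: h; exact: dnbhs0_lt.
  have h0 : h != 0 by near: h; exact: nbhs_dnbhs_neq.
  have he : `|h| <= e / (`|K| + 1).
    by near: h; apply: dnbhs0_le; rewrite divr_gt0 // ltr_wpDl.
  have hp : 0 < `|h| by rewrite normr_gt0.
  rewrite /= [_%:A]mulr1 -[d](scalerK h0) -scalerBr normrZ normfV distrC.
  rewrite ler_pdivrMl //; apply: le_trans (fq h hr) _.
  rewrite expr2 mulrA mulrC ler_wpM2l // (le_trans (ler_norm _)) //.
  rewrite normrM normr_id mulrC.
  apply: (@le_trans _ _ (e / (`|K| + 1) * (`|K| + 1))).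
    by rewrite ler_pM // lerDl.
  by rewrite divfK // gt_eqF // ltr_wpDl.
split; first exact/cvgP/fd.
by apply: cvg_lim fd => //.
Unshelve. all: by end_near. Qed.

(** The integral from [a] is handled only to the right of [a], so the base point moves with x. The
    value [G a x - G a 0] is the same for all a < -|x|, because two such integrals differ by a
    function with zero derivative. *)
Lemma continuous_primitive (f : R -> R) : continuous f ->
  exists F : R -> R, F 0 = 0 /\ forall t : R, is_derive t (1 : R) F (f t).
Proof.
move=> fc; pose G a x : R := (\int[mu]_(t in `[a, x]) f t)%R.
have Gd (a x : R) : a < x -> is_derive x (1 : R) (G a) (f x).
  move=> ax; have [||||Gd GE] := @continuous_FTC1_closed R f a x (x + 1).
  - by rewrite ltrDl.
  - apply: continuous_compact_integrable; first exact: segment_compact.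
    exact: continuous_subspaceT.
  - exact: ax.
  - exact: fc.
  by apply: DeriveDef; [exact: Gd|rewrite -derive1E].
have G_eq (a b x : R) : a < - `|x| -> b < - `|x| -> G a x - G a 0 = G b x - G b 0.
  move=> ax bx.
  pose y t : 'M[R]_1 := (G a t - G b t)%:M.
  have xN : - `|x| <= 0 by rewrite oppr_le0.
  have : `|y (x + 0) - y 0 - x *: 0| <= 0 * `|x|.
    apply: (@increment_le _ _ y (fun=> 0)) => // s sx _.
    have sxx : - `|x| <= s + 0.
      by rewrite addr0; move: sx; rewrite ler_norml => /andP[].
    split; last by rewrite subrr normr0.
    apply: is_derive_mx => i j; rewrite (ord1 i) (ord1 j).
    have -> : (fun t => y t 0 0) = G a - G b.
      by apply: funext => t; rewrite /y mxE eqxx mulr1n.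
    have ? := Gd a _ (lt_le_trans ax sxx).
    have ? := Gd b _ (lt_le_trans bx sxx).
    by apply: is_derive_eq; rewrite mxE subrr.
  rewrite mul0r normr_le0 scaler0 subr0 addr0 => /eqP/matrixP/(_ 0 0).
  rewrite !mxE eqxx !mulr1n => H; lra.
exists (fun x => G (- `|x| - 1) x - G (- `|x| - 1) 0); split.
  by rewrite subrr.
(* This base point serves all x at distance less than 1 from t, since then |x| < |t| + 1. *)
move=> t; pose a := - `|t| - 2.
have : is_derive t (1 : R) (G a - cst (G a 0)) (f t).
  have ? : is_derive t (1 : R) (G a) (f t).
    by apply: Gd; rewrite /a; have := ler_norm (- t); rewrite normrN; lra.
  by apply: is_derive_eq; rewrite subr0.
apply: near_eq_is_derive; near=> x.
have tx : `|t - x| < 1.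
  by near: x; have /cvgrPdist_lt := @cvg_id _ (nbhs t); apply.
rewrite -[LHS]/(G a x - G a 0); apply: G_eq; last by lra.
rewrite /a; have := ler_normB t (t - x); rewrite opprB addrC subrK; lra.
Unshelve. all: by end_near. Qed.

Lemma continuous_primitive_mx (m n : nat) (f : R -> 'M[R]_(m, n)) :
  continuous f ->
  exists F : R -> 'M[R]_(m, n), F 0 = 0 /\ forall t : R, is_derive t (1 : R) F (f t).
Proof.
move=> fc; have fcij i j : continuous (fun t => f t i j).
  by move=> t; have /continuous_mxP := fc t; apply.
pose F i j := sval (cid (continuous_primitive (fcij i j))).
have FP i j : F i j 0 = 0 /\ forall t : R, is_derive t (1 : R) (F i j) (f t i j).
  exact: (svalP (cid (continuous_primitive (fcij i j)))).
exists (fun t => \matrix_(i, j) F i j t); split.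
  by apply/matrixP => i j; rewrite !mxE; have [] := FP i j.
move=> t; apply: is_derive_mx => i j.
have -> : (fun x => (\matrix_(i, j) F i j x) i j) = F i j.
  by apply: funext => x; rewrite mxE.
by have [_] := FP i j; apply.
Qed.

(** The field is Lipschitz and bounded on the whole space, so the iterates live on all of R with the
    common Lipschitz constant M; only their convergence requires |t| < T. *)
Lemma picard (N : nat) (F : 'cV[R]_N -> 'cV[R]_N) (L M : R) (z0 : 'cV[R]_N) :
  0 < L -> (forall a b, `|F a - F b| <= L * `|a - b|) ->
  (forall a, `|F a| <= M) ->
  exists (T : R) (z : R -> 'cV[R]_N), [/\ 0 < T, z 0 = z0,
    forall t, `|t| < T -> `|z t - z0| <= M * `|t| &
    forall t : R, `|t| < T -> is_derive t (1 : R) z (F (z t))].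
Proof.
move=> L0 FL FM.
have M0 : 0 <= M by apply: le_trans (FM 0).
have Fc : continuous F.
  move=> a; change (F @ nbhs a --> F a).
  apply/(cvgrPdist_lt (FF := nbhs_filter a)) => e e0; near=> b.
  apply: le_lt_trans (FL a b) _; rewrite mulrC -ltr_pdivlMr //.
  near: b; have /cvgrPdist_lt := @cvg_id _ (nbhs a); apply.
  by rewrite divr_gt0.
(* Continuity is carried along with each iterate because the next one is a primitive of F composed
   with it. *)
pose contF := {w : R -> 'cV[R]_N | continuous w}.
have step (w : contF) : exists w' : contF, sval w' 0 = z0 /\
    forall t : R, is_derive t (1 : R) (sval w') (F (sval w t)).
  case: w => w wc; have Fwc : continuous (F \o w).
    by move=> t; apply: continuous_comp; [exact: wc|exact: Fc].
  have [G [G0 Gd]] := continuous_primitive_mx Fwc.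
  have Gd' t : is_derive t (1 : R) (cst z0 + G) (F (w t)).
    by have ? := Gd t; rewrite -[F (w t)]add0r; exact: is_deriveD.
  have Gc : continuous (cst z0 + G).
    by move=> t; apply: is_derive_continuous (Gd' t).
  exists (exist _ _ Gc); split => //=.
  by rewrite -[LHS]/(z0 + G 0) G0 addr0.
have c0 : continuous (cst z0 : R -> 'cV[R]_N) by exact: cst_continuous.
pose zs k := iter k (fun w => sval (cid (step w))) (exist _ _ c0).
pose z_ k := sval (zs k).
have z_0 k : z_ k 0 = z0.
  by case: k => [//|k]; rewrite /z_ /zs /= ; case: cid => x /= [].
have z_d k t : is_derive t (1 : R) (z_ k.+1) (F (z_ k t)).
  by rewrite /z_ /zs /=; case: cid => x /= [].
have z_lip k t u : `|z_ k u - z_ k t| <= M * `|u - t|.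
  case: k => [|k]; first by rewrite /z_ /= subrr normr0 mulr_ge0.
  have := @increment_le _ _ (z_ k.+1) (fun s => F (z_ k s)) t (u - t) M 0 M0.
  rewrite scaler0 subr0 subrK; apply => s _ _; split; first exact: z_d.
  by rewrite subr0.
(* With L T = 1/2 each iteration halves the distance between consecutive iterates. *)
pose T := (2 * L)^-1.
have T0 : 0 < T by rewrite invr_gt0 mulr_gt0.
have LT : L * T = 2^-1 by rewrite /T invfM mulrCA divff ?mulr1 // gt_eqF.
have z_close k t : `|t| < T -> `|z_ k.+1 t - z_ k t| <= M * T * 2^-1 ^+ k.
  elim: k t => [|k IH] t tT.
    have := z_lip 1 0 t; rewrite expr0 mulr1 z_0 subr0 => /le_trans; apply.
    by rewrite ler_wpM2l // ltW.
  pose C := M * T * 2^-1 ^+ k * L.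
  have C0 : 0 <= C by rewrite !mulr_ge0 ?exprn_ge0 // ltW.
  have := @increment_le _ _ (z_ k.+2 - z_ k.+1)
    (fun s => F (z_ k.+1 s) - F (z_ k s)) 0 t C 0 C0.
  rewrite scaler0 subr0 addr0 -[(_ - _) 0]/(z_ k.+2 0 - z_ k.+1 0) !z_0 subrr.
  rewrite subr0 => H; apply: le_trans (H _) _ => [s st _|].
    split.
      have ? := z_d k.+1 (s + 0); have ? := z_d k (s + 0).
      exact: is_derive_eq.
    rewrite subr0 (le_trans (FL _ _)) // addr0 mulrC ler_wpM2r ?(ltW L0) //.
    by apply: IH; apply: le_lt_trans tT.
  have -> : M * T * 2^-1 ^+ k.+1 = C * T.
    by rewrite exprS /C; set q := 2^-1 ^+ k; rewrite -LT; ring.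
  by rewrite ler_wpM2l // ltW.
have z_far k j t : `|t| < T ->
    `|z_ (j + k)%N t - z_ k t| <= 2 * (M * T) * 2^-1 ^+ k.
  move=> tT; set A := M * T.
  suff : `|z_ (j + k)%N t - z_ k t| <= 2 * A * 2^-1 ^+ k - 2 * A * 2^-1 ^+ (j + k).
    move=> /le_trans -> //; rewrite gerBl; apply: mulr_ge0.
      by rewrite mulr_ge0 // mulr_ge0 // ltW.
    by apply: exprn_ge0; rewrite invr_ge0.
  elim: j => [|j IH]; first by rewrite add0n !subrr normr0.
  have := z_close (j + k)%N t tT.
  rewrite -/A addSn exprS => H.
  have := ler_normD (z_ (j + k).+1 t - z_ (j + k)%N t) (z_ (j + k)%N t - z_ k t).
  rewrite addrA subrK => /le_trans -> //.
  apply: le_trans (lerD H IH) _.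
  set q := _ ^+ (j + k); set q' := _ ^+ k; lra.
have z_cvg t : `|t| < T -> cvg (z_ ^~ t @ \oo).
  move=> tT; apply/cauchy_cvgP/cauchy_exP => e e0.
  have : (geometric (2 * (M * T)) 2^-1 : R^nat) @ \oo --> (0 : R).
    by apply: cvg_geometric; rewrite ger0_norm // invf_lt1 // ltr1n.
  move/cvgrPdist_lt => /(_ e e0) [k _ /(_ k (leqnn k))] /= kP.
  exists (z_ k t); exists k => // i /= ki.
  rewrite -ball_normE /= distrC -(subnK ki).
  apply: le_lt_trans (z_far _ _ _ tT) _.
  by apply: le_lt_trans kP; rewrite sub0r normrN ler_norm.
pose z t := lim (z_ ^~ t @ \oo).
have z_z t k : `|t| < T -> `|z t - z_ k t| <= 2 * (M * T) * 2^-1 ^+ k.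
  move=> tT.
  have zc : (fun j => `|z_ j t - z_ k t|) @ \oo --> `|z t - z_ k t|.
    by apply: cvg_norm; apply: cvgB; [exact: z_cvg|exact: cvg_cst].
  apply: (cvgr_to_le zc).
  by exists k => // j /= kj; rewrite -(subnK kj); exact: z_far.
have zlip t u : `|t| < T -> `|u| < T -> `|z u - z t| <= M * `|u - t|.
  move=> tT uT.
  have zc : (fun j => `|z_ j u - z_ j t|) @ \oo --> `|z u - z t|.
    by apply: cvg_norm; apply: cvgB; exact: z_cvg.
  apply: (cvgr_to_le zc).
  by near do exact: z_lip.
exists T, z; split => //.
- rewrite /z; have -> : z_ ^~ 0 = cst z0 by apply: funext => k; exact: z_0.
  exact: lim_cst.
- move=> t tT; rewrite -[z0](_ : z 0 = _); last first.
    rewrite /z; have -> : z_ ^~ 0 = cst z0 by apply: funext => k; exact: z_0.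
    exact: lim_cst.
  by rewrite -[X in _ * `|X|]subr0; apply: zlip; rewrite ?normr0.
move=> t tT; apply: (@is_derive_quadratic _ _ _ _ (L * M) (T - `|t|)).
  by rewrite subr_gt0.
move=> h hT.
have sT s : `|s| <= `|h| -> `|s + t| < T.
  by move=> sh; have := ler_normD s t; lra.
pose A k : R := 2 * (M * T) * 2^-1 ^+ k.
pose B := L * M * `|h| ^+ 2.
(* The estimate is made on [z_ k.+1]. Replacing z by iterates at the two ends and inside F costs a
   multiple of [A k], which disappears as k grows and leaves the quadratic bound [B]. *)
suff le_k k : `|z (h + t) - z t - h *: F (z t)| <= B + (2 + L * `|h|) * A k.
  have gB : (fun k => B + geometric ((2 + L * `|h|) * (2 * (M * T))) 2^-1 k) @ \oo --> B.
    rewrite -[X in _ --> X]addr0; apply: cvgD; first exact: cvg_cst.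
    by apply: cvg_geometric; rewrite ger0_norm // invf_lt1 // ltr1n.
  apply: (cvgr_to_ge gB); near=> k.
  by rewrite /geometric /= -mulrA; exact: le_k.
have A0 : 0 <= A k by rewrite /A !mulr_ge0 ?exprn_ge0 // ltW.
have AS : A k.+1 <= A k.
  rewrite /A exprS mulrCA ler_piMl // invf_le1 // ler1n //.
have C0 : 0 <= L * A k + L * (M * `|h|).
  by rewrite addr_ge0 // !mulr_ge0 // ltW.
have := @increment_le _ _ (z_ k.+1) (fun s => F (z_ k s)) t h _ (F (z t)) C0.
have hT' : `|h + t| < T by apply: sT.
have H1 := z_z _ k.+1 tT; have H2 := z_z _ k.+1 hT'; rewrite -/(A _) in H1 H2.
move=> H; have {}H := H _.
have -> : z (h + t) - z t - h *: F (z t) =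
    (z (h + t) - z_ k.+1 (h + t)) - (z t - z_ k.+1 t) +
    (z_ k.+1 (h + t) - z_ k.+1 t - h *: F (z t)).
  by rewrite opprB !addrA; apply/matrixP => i j; rewrite !mxE; ring.
apply: le_trans (ler_normD _ _) _; apply: le_trans (lerD (ler_normB _ _) (H _)) _.
  move=> s sh _; split; first exact: z_d.
  have sT' := sT s sh.
  apply: le_trans (FL _ _) _; rewrite -mulrDr ler_wpM2l ?(ltW L0) //.
  rewrite -(subrK (z (s + t)) (z_ k (s + t))) -addrA.
  apply: le_trans (ler_normD _ _) _; apply: lerD.
    by rewrite distrC; exact: z_z.
  by apply: le_trans (zlip _ _ tT sT') _; rewrite addrK ler_wpM2l.
rewrite /B expr2; have := normr_ge0 h; nra.
Unshelve. all: by end_near. Qed.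

End Picard.

(** * Local solutions, their smoothness, and geodesics *)

Section Ode.
Variable R : realType.

Lemma is_deriveZ_dir (W : normedModType R) (f : R -> W) (t v : R) (d : W) :
  is_derive t (1 : R) f d -> is_derive t v f (v *: d).
Proof.
case=> fd <-; have fdiff : differentiable f t by apply/derivable1_diffP.
split; first exact: diff_derivable.
by rewrite !deriveE // -[in LHS](mulr1 v) -[v * 1]/(v *: (1 : R)) linearZ.
Qed.

Lemma is_derive_comp1 (W : normedModType R) (f : R -> W) (u : R -> R) (t a : R) (d : W) :
  is_derive (u t) (1 : R) f d -> is_derive t (1 : R) u a ->
  is_derive t (1 : R) (f \o u) (a *: d).
Proof.
case=> fd <- [ud <-].
have fdiff : differentiable f (u t) by apply/derivable1_diffP.
have udiff : differentiable u t by apply/derivable1_diffP.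
have fu : differentiable (f \o u) t by apply: differentiable_comp.
have fuE : 'd (f \o u) t = 'd f (u t) \o 'd u t :> (R -> W) by exact: diff_comp.
split; first exact: diff_derivable.
rewrite (deriveE _ fu) fuE /= (deriveE _ fdiff) (deriveE _ udiff).
by rewrite -[in LHS](mulr1 ('d u t 1)) -[_ * 1]/(_ *: (1 : R)) linearZ.
Qed.

Lemma Ck_id r (U : set R) : Ck r U (fun x : R => x).
Proof.
case: r => [|r]; first by split=> // x _; exact: cvg_id.
split=> [x _|v]; first exact: cvg_id.
split=> [x _|]; first exact: derivable_id.
have -> : 'D_v (fun x : R => x) = cst v by apply: funext => x; exact: derive_id.
exact: Ck_cst.
Qed.

Lemma Ck_coord (n r : nat) (U : set 'cV[R]_n) k : Ck r U (fun z => z k 0).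
Proof.
case: r => [|r]; first by split=> // x _; exact: coord_continuous.
split=> [x _|v]; first exact: coord_continuous.
have dc x : is_derive x v (fun z : 'cV[R]_n => z k 0) (v k 0).
  by apply: is_derive_coord; exact: is_derive_id.
split=> [x _|]; first by have [] := dc x.
have -> : 'D_v (fun z : 'cV[R]_n => z k 0) = cst (v k 0).
  by apply: funext => x; have [_ ->] := dc x.
exact: Ck_cst.
Qed.

Lemma Ck_comp1 (f u : R -> R) (U U' : set R) r : open U -> open U' ->
  (forall t, U' t -> U (u t)) -> Ck r U f -> Ck r U' u -> Ck r U' (f \o u).
Proof.
move=> Uo U'o uU; elim: r f => [|r IH] f fr ur.
  split=> // t Ut; apply: continuous_comp; first exact: Ck_continuous ur Ut.
  by apply: Ck_continuous fr _; apply: uU.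
have fu t v : U' t -> is_derive t v (f \o u) ('D_v u t * 'D_1 f (u t)).
  move=> Ut.
  have ud : derivable u t 1 by exact: Ck_derivable ur Ut.
  have fd : derivable f (u t) 1 by exact: Ck_derivable fr (uU _ Ut).
  have := is_deriveZ_dir v (is_derive_comp1 (derivableP fd) (derivableP ud)).
  case=> fud E; split=> //; rewrite E.
  have [_ ->] := is_deriveZ_dir v (derivableP ud).
  by rewrite -[LHS]/(_ * (_ * _)) mulrA.
split=> [t Ut|v].
  apply: continuous_comp; first exact: Ck_continuous ur Ut.
  by apply: Ck_continuous fr _; apply: uU.
split=> [t Ut|]; first by have [] := fu t v Ut.
apply: (@eq_Ck _ _ _ _ _ (fun t => 'D_v u t * ('D_1 f \o u) t)) => //.
  by move=> t Ut; have [_ ->] := fu t v Ut.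
apply: CkM => //; first exact: Ck_derive.
by apply: IH; [exact: Ck_derive|exact: Ck_pred].
Qed.

Lemma Ck_atan r (U : set R) : open U -> Ck r U atan.
Proof.
move=> Uo; case: r => [|r]; first by split=> // x _; exact: continuous_atan.
split=> [x _|v]; first exact: continuous_atan.
have ad x := is_deriveZ_dir v (is_derive1_atan x).
split=> [x _|]; first by have [] := ad x.
apply: (@eq_Ck _ _ _ _ _ (fun x : R => v * (1 + x * x)^-1)) => //.
  by move=> x _; have [_ ->] := ad x; rewrite -expr2.
apply: CkM => //; first exact: Ck_cst.
apply: CkV => // [x _|].
  by rewrite -expr2 gt_eqF // ltr_pwDl // sqr_ge0.
by apply: CkD => //; [exact: Ck_cst|apply: CkM => //; exact: Ck_id].
Qed.

Lemma C1_lipschitz (N : nat) (U : set 'cV[R]_N) (F : 'cV[R]_N -> 'cV[R]_N) z0 :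
  open U -> Ck 1 U F -> U z0 -> exists r L M : R,
  [/\ 0 < r, 0 < L, forall a, `|a - z0| < r -> U a,
      forall a, `|a - z0| < r -> `|F a| <= M &
      forall a b, `|a - z0| < r -> `|b - z0| < r -> `|F a - F b| <= L * `|a - b|].
Proof.
move=> Uo /(Ck_mxP _ _ Uo) F1 Uz0.
pose g i z := F z i 0.
have : \forall z \near z0, U z /\ forall ik : 'I_N * 'I_N,
    `|'D_(delta_mx ik.2 0) (g ik.1) z0 - 'D_(delta_mx ik.2 0) (g ik.1) z| < 1.
  near=> z; split; near: z; first exact: open_nbhs_nbhs.
  apply: filter_forall => -[i k].
  have /cvgrPdist_lt := Ck_continuous (Ck_derive (delta_mx k 0) (F1 i 0)) Uz0.
  exact.
case/nbhs_ballP => r /= r0 rP.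
(* Near z0 every partial derivative is within 1 of its value at z0. Summing over all i bounds every
   component of F at once, and the leading 1 keeps L positive when N = 0. *)
pose L := 1 + \sum_i \sum_k (1 + `|'D_(delta_mx k 0) (g i) z0|).
have L0 : 0 < L.
  by rewrite ltr_pwDl // sumr_ge0 // => i _; rewrite sumr_ge0 // => k _; rewrite addr_ge0.
have FL a b : `|a - z0| < r -> `|b - z0| < r -> `|F a - F b| <= L * `|a - b|.
  move=> ar br; apply/mx_norm_leP => [|i j]; first by rewrite mulr_ge0 // ltW.
  rewrite (ord1 j) !mxE -/(g i a) -/(g i b).
  have H z k : `|z - z0| < r -> derivable (g i) z (delta_mx k 0) /\
      `|'D_(delta_mx k 0) (g i) z - 'D_(delta_mx k 0) (g i) z0| <= 1.
    move=> zr; have [|Uz /(_ (i, k)) /= gz] := rP z.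
      by rewrite -ball_normE /= distrC.
    by split; [exact: Ck_derivable (F1 i 0) Uz|rewrite distrC ltW].
  have := increment_bound H br ar; set S := \sum_k _; set S' := \sum_k _ => gS.
  have -> : g i a - g i b = (g i a - g i b - S) + S by rewrite subrK.
  apply: le_trans (ler_normD _ _) _.
  apply: (@le_trans _ _ (\sum_k (1 + `|'D_(delta_mx k 0) (g i) z0|) * `|a - b|)).
    have -> : \sum_k (1 + `|'D_(delta_mx k 0) (g i) z0|) * `|a - b| =
        \sum_(k < N) `|a - b| + \sum_k `|'D_(delta_mx k 0) (g i) z0| * `|a - b|.
      by rewrite -big_split /=; apply: eq_bigr => k _; rewrite mulrDl mul1r.
    apply: lerD.
      rewrite mul1r in gS; apply: le_trans gS _; apply: ler_sum => k _.
      by have := mx_coord_le (a - b) k 0; rewrite !mxE.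
    apply: le_trans (ler_norm_sum _ _ _) _; apply: ler_sum => k _.
    rewrite normrM mulrC ler_wpM2l //.
    by have := mx_coord_le (a - b) k 0; rewrite !mxE.
  rewrite -mulr_suml ler_wpM2r //.
  rewrite /L [X in _ <= _ + X](bigD1 i) //= addrCA lerDl addr_ge0 // sumr_ge0 // => i' _.
  by rewrite sumr_ge0 // => k _; rewrite addr_ge0.
exists r, L, (`|F z0| + L * r); split => //.
- by move=> a ar; have [|] := rP a; rewrite // -ball_normE /= distrC.
- move=> a ar; rewrite -(subrK (F z0) (F a)) addrC.
  apply: le_trans (ler_normD _ _) _; rewrite lerD2l.
  apply: le_trans (FL a z0 ar _) _; first by rewrite subrr normr0.
  by rewrite ler_pM2l // ltW.
Unshelve. all: by end_near. Qed.

(** The field is controlled only near z0, so it is composed with the retraction [rho] onto a cube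
    around z0, obtained by clamping each coordinate and 1-Lipschitz for the sup norm. The composite
    satisfies the global hypotheses of [picard], and it coincides with F while the solution remains
    in the cube; at speed at most M this holds for |t| < q / (M + 1). *)
Lemma ode_solution (N : nat) (U : set 'cV[R]_N) (F : 'cV[R]_N -> 'cV[R]_N) z0 :
  open U -> Ck 1 U F -> U z0 -> exists (T : R) (z : R -> 'cV[R]_N),
  [/\ 0 < T, z 0 = z0, forall t, `|t| < T -> U (z t) &
      forall t : R, `|t| < T -> is_derive t (1 : R) z (F (z t))].
Proof.
move=> Uo F1 Uz0; have [r [L [M [r0 L0 rU FM FL]]]] := C1_lipschitz Uo F1 Uz0.
pose q := r / 2.
have q0 : 0 < q by rewrite divr_gt0.
have qr : q < r by rewrite ltr_pdivrMr // ltr_pMr // ltr1n.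
pose c (s : R) := Num.max (- q) (Num.min s q).
have c_lip s t : `|c s - c t| <= `|s - t|.
  have := ler_norm (s - t); have := ler_norm (t - s); rewrite (distrC t s).
  set D := `|s - t| => h1 h2; rewrite ler_norml /c /Order.max /Order.min.
  by case: (ltP s q) => ?; case: ltP => ?; case: (ltP t q) => ?;
    case: ltP => ?; apply/andP; split; lra.
have c_le s : `|c s| <= q.
  rewrite ler_norml /c /Order.max /Order.min.
  by case: (ltP s q) => ?; case: ltP => ?; apply/andP; split; lra.
have c_id s : `|s| <= q -> c s = s.
  rewrite ler_norml /c /Order.max /Order.min => /andP[? ?].
  by case: (ltP s q) => ?; case: ltP => ?; lra.
pose rho (a : 'cV[R]_N) : 'cV[R]_N := \col_i (z0 i 0 + c (a i 0 - z0 i 0)).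
have rho_lip a b : `|rho a - rho b| <= `|a - b|.
  apply/mx_norm_leP => // i j; rewrite !mxE.
  rewrite opprD addrACA subrr add0r (le_trans (c_lip _ _)) //.
  have -> : a i 0 - z0 i 0 - (b i 0 - z0 i 0) = (a - b) i 0 by rewrite !mxE; ring.
  exact: mx_coord_le.
have rho_r a : `|rho a - z0| < r.
  apply: le_lt_trans qr; apply/mx_norm_leP => [|i j]; first exact: ltW.
  by rewrite !mxE (ord1 j) addrAC subrr add0r.
have rho_id a : `|a - z0| <= q -> rho a = a.
  move=> /mx_norm_leP aq; apply/matrixP => i j; rewrite !mxE (ord1 j) c_id.
    by rewrite addrC subrK.
  by have := aq (ltW q0) i 0; rewrite !mxE.
have [| | T [z [T0 z_0 z_le zd]]] := @picard R N (F \o rho) L M z0 L0.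
- by move=> a b /=; apply: le_trans (FL _ _ _ _) _ => //; rewrite ler_pM2l.
- by move=> a /=; apply: FM.
have M0 : 0 <= M by apply: le_trans (FM z0 _); rewrite ?subrr ?normr0.
pose T' := Num.min T (q / (M + 1)).
have T'T (t : R) : `|t| < T' -> `|t| < T by rewrite /T' lt_min => /andP[].
have zq t : `|t| < T' -> `|z t - z0| <= q.
  move=> tT'; apply: le_trans (z_le t (T'T t tT')) _.
  move: tT'; rewrite /T' lt_min => /andP[_].
  rewrite ltr_pdivlMr ?ltr_wpDl // => tq; have := normr_ge0 t; nra.
exists T', z; split => //.
- by rewrite /T' lt_min T0 divr_gt0 // ltr_wpDl.
- by move=> t tT'; apply: rU; apply: le_lt_trans qr; exact: zq.
by move=> t tT'; have := zd t (T'T t tT'); rewrite /= rho_id //; exact: zq.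
Qed.

Lemma open_norm_lt (T : R) : open [set t : R | `|t| < T].
Proof.
apply: (@open_comp _ _ (fun t : R => `|t|) [set x | x < T]) => //.
by move=> t _; exact: norm_continuous.
Qed.

(** Bootstrap: if z is C^r, so is its derivative F o z, hence z is C^(r+1). *)
Lemma ode_smooth (N : nat) (U : set 'cV[R]_N) (F : 'cV[R]_N -> 'cV[R]_N)
    (I : set R) (z : R -> 'cV[R]_N) :
  open U -> open I -> smooth_on U F -> (forall t, I t -> U (z t)) ->
  (forall t : R, I t -> is_derive t (1 : R) z (F (z t))) -> smooth_on I z.
Proof.
move=> Uo Io Fs zU zd; elim=> [|r IH].
  by split=> // t It; apply: is_derive_continuous (zd t It).
split=> [t It|v]; first exact: is_derive_continuous (zd t It).
split=> [t It|]; first by have [] := is_deriveZ_dir v (zd t It).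
apply: (@eq_Ck _ _ _ _ _ (fun t => v *: (F \o z) t)) => //.
  by move=> t It; have [_ ->] := is_deriveZ_dir v (zd t It).
have /(Ck_mxP _ _ Io) Fz := Ck_comp_mx Uo Io zU (Fs r) IH.
apply/(Ck_mxP _ _ Io) => i j.
apply: (@eq_Ck _ _ _ _ _ (fun t => v * (F \o z) t i j)) => // [t _|].
  by rewrite mxE.
by apply: CkM => //; exact: Ck_cst.
Qed.

Lemma tens_expand (n : nat) (T : tens R n) (X : 'cV[R]_n) :
  T X = \sum_j X j 0 *: T (delta_mx j 0).
Proof.
rewrite {1}[X]matrix_sum_delta linear_sum; apply: eq_bigr => j _.
by rewrite big_ord1 linearZ.
Qed.

(* The geodesic with the given initial data exists on some interval (-T, T);
   composing it with T / 2 * atan makes it a curve defined on the whole of R,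
   whose acceleration is no longer zero but proportional to the velocity. *)
Lemma geodesic_exists (n : nat) (U : set 'cV[R]_n) (Gamma : 'cV[R]_n -> tens R n)
    x0 X :
  open U -> (forall Y, smooth_on U (fun x => Gamma x Y)) -> U x0 ->
  exists (y : R -> 'cV[R]_n) (c : R), [/\ c != 0, smooth_on setT y,
    forall h, U (y h), y 0 = x0 /\ derive1 y 0 = c *: X & forall h, exists a : R,
      derive1n 2 y h + Gamma (y h) (derive1 y h) *m derive1 y h =
      a *: derive1 y h].
Proof.
move=> Uo Gs Ux0.
(* The geodesic equation as a first order system in the pair (position, velocity). *)
pose F (z : 'cV[R]_(n + n)) : 'cV[R]_(n + n) :=
  col_mx (dsubmx z) (- (Gamma (usubmx z) (dsubmx z) *m dsubmx z)).
have us r V : open V -> Ck r V (usubmx : 'cV[R]_(n + n) -> 'cV[R]_n).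
  move=> Vo; apply/Ck_mxP => // i j; rewrite (ord1 j).
  by apply: (eq_Ck Vo _ (Ck_coord r V (lshift n i))) => z _; rewrite mxE.
have ds r V i : open V -> Ck r V (fun z : 'cV[R]_(n + n) => dsubmx z i 0).
  move=> Vo.
  by apply: (eq_Ck Vo _ (Ck_coord r V (rshift n i))) => z _; rewrite mxE.
pose U2 := [set z : 'cV[R]_(n + n) | U (usubmx z)].
have U2o : open U2.
  apply: (@open_comp _ _ (usubmx : 'cV[R]_(n + n) -> 'cV[R]_n) U) => //.
  by move=> z _; apply: Ck_continuous (us 0 setT openT) _.
have Fs : smooth_on U2 F.
  move=> r; apply/Ck_mxP => // i j; rewrite (ord1 j) -(splitK i).
  case: (fintype.split i) => k /=.
    by apply: (eq_Ck U2o _ (ds r U2 k U2o)) => z _; rewrite /F col_mxEu.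
  apply: (@eq_Ck _ _ _ _ _ (fun z => - \sum_i (\sum_j dsubmx z j 0 *
      ((fun x => Gamma x (delta_mx j 0) k i) \o usubmx) z) * dsubmx z i 0)) => //.
    move=> z _; rewrite /F col_mxEd !mxE; congr (- _); apply: eq_bigr => i' _.
    congr (_ * _); rewrite [in RHS]tens_expand summxE; apply: eq_bigr => j' _.
    by rewrite [RHS]mxE.
  apply: CkN => //; apply: Ck_sum => // i'; apply: CkM => //; last exact: ds.
  apply: Ck_sum => // j'; apply: CkM => //; first exact: ds.
  apply: (@Ck_comp _ _ _ _ U) => //; last exact: us.
  by have /(Ck_mxP _ _ Uo) := Gs (delta_mx j' 0) r; apply.
have [|T [z [T0 z_0 zU zd]]] := ode_solution (z0 := col_mx x0 X) U2o (Fs 1).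
  by rewrite /U2 /= col_mxKu.
pose I := [set t : R | `|t| < T].
have Io : open I by exact: open_norm_lt.
have zs : smooth_on I z by exact: (ode_smooth U2o Io Fs zU zd).
pose x t := usubmx (z t); pose v t := dsubmx (z t).
have xd t : I t -> is_derive t (1 : R) x (v t).
  move=> It; apply: is_derive_mx => i j; rewrite (ord1 j).
  have -> : (fun t => x t i 0) = (fun t => z t (lshift n i) 0).
    by apply: funext => s; rewrite mxE.
  have -> : v t i 0 = F (z t) (lshift n i) 0 by rewrite /F col_mxEu.
  exact/is_derive_coord/zd.
have vd t : I t -> is_derive t (1 : R) v (- (Gamma (x t) (v t) *m v t)).
  move=> It; apply: is_derive_mx => i j; rewrite (ord1 j).
  have -> : (fun t => v t i 0) = (fun t => z t (rshift n i) 0).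
    by apply: funext => s; rewrite mxE.
  have -> : (- (Gamma (x t) (v t) *m v t)) i 0 = F (z t) (rshift n i) 0.
    by rewrite /F col_mxEd.
  exact/is_derive_coord/zd.
(* Since |atan| < pi/2 < 2, the values of u stay in (-T, T). *)
pose u (h : R) := T / 2 * atan h; pose u1 (h : R) := T / 2 * (1 + h ^+ 2)^-1.
have uI h : I (u h).
  rewrite /I /= /u normrM gtr0_norm ?divr_gt0 //.
  have : `|atan h| < 2.
    have := atan_gtNpi2 h; have := atan_ltpi2 h; have := @pihalf_lt2 R => ? ? ?.
    by rewrite ltr_norml; apply/andP; split; lra.
  by move=> a2; have := normr_ge0 (atan h); nra.
have ud h : is_derive h (1 : R) u (u1 h).
  have ? := is_derive1_atan h.
  have -> : u = (T / 2) *: (atan : R -> R) by apply: funext.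
  exact: is_derive_eq.
have u1_neq0 h : u1 h != 0.
  rewrite /u1 mulf_neq0 //; first by rewrite gt_eqF // divr_gt0.
  by rewrite invr_neq0 // gt_eqF // ltr_pwDl // sqr_ge0.
have u1d h : derivable u1 h 1.
  have s1 : Ck 1 setT u1.
    apply: CkM; [exact: openT|exact: Ck_cst|apply: CkV; first exact: openT].
      by move=> w _; rewrite gt_eqF // ltr_pwDl // sqr_ge0.
    apply: CkD; [exact: openT|exact: Ck_cst|].
    by apply: CkM; [exact: openT|exact: Ck_id|exact: Ck_id].
  exact: Ck_derivable s1 _.
have us' : smooth_on setT u.
  by move=> r; apply: CkM; [exact: openT|exact: Ck_cst|apply: Ck_atan; exact: openT].
pose y h := x (u h).
have yd h : is_derive h (1 : R) y (u1 h *: v (u h)).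
  exact: (is_derive_comp1 (xd _ (uI h)) (ud h)).
have y1 : derive1 y = fun h => u1 h *: v (u h).
  by apply: funext => h; rewrite derive1E; have [_ ->] := yd h.
have y2 h : derive1n 2 y h = 'D_1 u1 h *: v (u h) +
    u1 h *: (u1 h *: - (Gamma (x (u h)) (v (u h)) *m v (u h))).
  rewrite /derive1n /= y1 derive1E.
  have vud := is_derive_comp1 (vd _ (uI h)) (ud h).
  suff : is_derive h (1 : R) (fun h => u1 h *: v (u h)) ('D_1 u1 h *: v (u h) +
      u1 h *: (u1 h *: - (Gamma (x (u h)) (v (u h)) *m v (u h)))) by case.
  apply: is_derive_mx => i j.
  have ? : is_derive h (1 : R) u1 ('D_1 u1 h) by exact: derivableP.
  have ? := is_derive_coord i j vud.
  have -> : (fun h => (u1 h *: v (u h)) i j) = u1 * (fun h => (v \o u) h i j).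
    by apply: funext => w; rewrite [LHS]mxE.
  by apply: is_derive_eq; rewrite /GRing.scale /= !mxE; ring.
exists y, (u1 0); split => //.
- move=> r; apply/Ck_mxP; first exact: openT.
  move=> i j; apply: (@Ck_comp1 (fun t => x t i j) u I setT) => //.
    exact: openT.
  rewrite (ord1 j).
  apply: (@eq_Ck _ _ _ _ _ (fun t => z t (lshift n i) 0)) => //.
    by move=> t _; rewrite mxE.
  by have /(Ck_mxP _ _ Io) := zs r; apply.
- by move=> h; apply: zU; exact: uI.
- have u0 : u 0 = 0 by rewrite /u atan0 mulr0.
  rewrite y1 /y u0 /x /v z_0 col_mxKu col_mxKd; split => //.
(* As y' = u' v, the geodesic equation cancels the terms in u'^2 and leaves u'' v = (u'' / u')
   y'. *)
move=> h; exists ('D_1 u1 h / u1 h).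
rewrite y2 y1 [RHS]scalerA divfK //.
have -> : Gamma (y h) (u1 h *: v (u h)) = u1 h *: Gamma (y h) (v (u h)).
  by rewrite linearZ.
by rewrite -scalemxAl -scalemxAr !scalerN -addrA addNr addr0.
Qed.

End Ode.

(** * The standard basis of the Clifford algebra *)

(** Every set of generators is the set of nonzero digits of some index, so the standard basis
    contains the increasing product over each subset. *)
Lemma binary_digits (p : nat) (f : nat -> bool) :
  exists2 j, (j < 2 ^ p)%N & forall i, (i < p)%N -> odd (j %/ 2 ^ i) = f i.
Proof.
elim: p f => [|p IH] f; first by exists 0.
have [j jp jf] := IH (fun i => f i.+1).
have half_j : ((f 0%N + j * 2) %/ 2 = j)%N.
  by rewrite addnC divnMDl //; case: (f 0%N); rewrite divn_small // addn0.
exists (f 0%N + j * 2)%N; first by rewrite expnS; case: (f 0%N); lia.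
case=> [|i] ip; first by rewrite expn0 divn1 oddD oddM andbF addbF; case: (f 0%N).
by rewrite expnS divnMA half_j jf.
Qed.

Section SignedMonomials.
Variables (R : realType) (p : nat) (O : falgType R) (e : 'I_p -> O).
Hypothesis e_sqr : forall i, exists c : bool, e i * e i = (-1) ^+ c.
Hypothesis e_anti : forall i j, i != j -> e i * e j = - (e j * e i).

(** Signs are kept as booleans under [(-1) ^+ c], so that multiplying signs is [(+)]. *)
Definition sign_commute (x y : O) := exists c : bool, x * y = (-1) ^+ c * (y * x).

Lemma sign_commute_sym x y : sign_commute x y -> sign_commute y x.
Proof. by case=> c E; exists c; rewrite E signrMK. Qed.

Lemma sign_commuteM x y z :
  sign_commute x y -> sign_commute x z -> sign_commute x (y * z).
Proof.
case=> c xy [d xz]; exists (c (+) d).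
rewrite mulrA xy -!mulrA xz signr_addb -!mulrA; congr (_ * _).
by rewrite !mulrA; congr (_ * _ * _); apply: commr_sign.
Qed.

Lemma sign_commute_e i j : sign_commute (e i) (e j).
Proof.
have [->|ij] := eqVneq i j; first by exists false; rewrite mul1r.
by exists true; rewrite e_anti // expr1 mulN1r.
Qed.

Lemma sign_commute_prod x (s : seq 'I_p) P :
  (forall i, sign_commute x (e i)) -> sign_commute x (\prod_(i <- s | P i) e i).
Proof.
move=> xe; elim: s => [|i s IH].
  by rewrite big_nil; exists false; rewrite mul1r mulr1 mul1r.
by rewrite big_cons; case: ifP => // _; apply: sign_commuteM.
Qed.

Lemma sign_sqrM x y : sign_commute x y -> (exists c : bool, x * x = (-1) ^+ c) ->
  (exists c : bool, y * y = (-1) ^+ c) ->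
  exists c : bool, (x * y) * (x * y) = (-1) ^+ c.
Proof.
move=> /sign_commute_sym[c xy] [d xx] [f yy]; exists (c (+) d (+) f).
rewrite -mulrA [y * (x * y)]mulrA xy -!mulrA yy !signr_addb.
rewrite [x * ((-1) ^+ c * _)]mulrA (commr_sign x c) -!mulrA; congr (_ * _).
by rewrite mulrA xx.
Qed.

Lemma sign_sqr_prod (s : seq 'I_p) P : exists c : bool,
  \prod_(i <- s | P i) e i * \prod_(i <- s | P i) e i = (-1) ^+ c.
Proof.
elim: s => [|i s IH]; first by rewrite big_nil; exists false; rewrite mul1r.
rewrite big_cons; case: ifP => // _; apply: sign_sqrM => //.
by apply: sign_commute_prod => j; exact: sign_commute_e.
Qed.

(** The generator moves to its place by anticommutation and there either meets its own copy and
    squares to a sign, or is inserted. The index set changes by symmetric difference with {i}. *)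
Lemma mul_gen_prod (s : seq 'I_p) P i : uniq s -> i \in s ->
  exists c : bool, e i * \prod_(j <- s | P j) e j =
    (-1) ^+ c * \prod_(j <- s | (j == i) (+) P j) e j.
Proof.
elim: s => [//|a s IH] /= /andP[aNs us]; rewrite inE !big_cons.
have [ia _|ia /= is_] := eqVneq i a; last first.
  have [c E] := IH us is_.
  case: (P a); last by exists c.
  exists (~~ c); rewrite mulrA e_anti // mulNr -mulrA E signrN mulNr.
  by rewrite !mulrA (commr_sign (e a)).
subst a.
have -> : \prod_(j <- s | (j == i) (+) P j) e j = \prod_(j <- s | P j) e j.
  rewrite big_seq_cond [RHS]big_seq_cond; apply: eq_bigl => j.
  have [->|//] := eqVneq j i.
  by rewrite (negPf aNs).
case: (P i) => /=; last by exists false; rewrite mul1r.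
by have [c E] := e_sqr i; exists c; rewrite mulrA E.
Qed.

Definition monomial (P : pred 'I_p) : O := \prod_(i < p | P i) e i.

Lemma mul_gen_monomial P i : exists (c : bool) Q,
  e i * monomial P = (-1) ^+ c * monomial Q.
Proof.
have [||c E] := @mul_gen_prod (index_enum 'I_p) P i.
- exact: index_enum_uniq.
- exact: mem_index_enum.
by exists c, (fun j => (j == i) (+) P j).
Qed.

Lemma mul_monomial P Q : exists (c : bool) S,
  monomial P * monomial Q = (-1) ^+ c * monomial S.
Proof.
rewrite {1}/monomial; elim: (index_enum _) => [|i s [c [S E]]].
  by exists false, Q; rewrite big_nil.
rewrite big_cons; case: ifP => _; last by exists c, S.
have [d [S' E']] := mul_gen_monomial S i.
exists (c (+) d), S'; rewrite -mulrA E mulrA (commr_sign (e i)) -mulrA E'.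
by rewrite mulrA signr_addb.
Qed.

Lemma monomial_sqr P : exists c : bool, monomial P * monomial P = (-1) ^+ c.
Proof. exact: sign_sqr_prod. Qed.

Lemma monomial_comm P Q : sign_commute (monomial P) (monomial Q).
Proof.
apply: sign_commute_prod => i; apply: sign_commute_sym.
by apply: sign_commute_prod => j; exact: sign_commute_e.
Qed.

Lemma std_basisE (j : 'I_(2 ^ p)) :
  tnth (std_basis e) j = monomial (fun i => odd (j %/ 2 ^ i)).
Proof. by rewrite tnth_mktuple. Qed.

Lemma monomial_std P : exists j : 'I_(2 ^ p), monomial P = tnth (std_basis e) j.
Proof.
have [j jp jP] := binary_digits p
  (fun i => if insub i is Some k then P k else false).
exists (Ordinal jp); rewrite std_basisE; apply: eq_bigl => i /=.
by rewrite jP // valK.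
Qed.

Local Notation b := (tnth (std_basis e)).

Lemma std_basis_mul i j : exists (c : bool) l, b i * b j = (-1) ^+ c * b l.
Proof.
rewrite !std_basisE.
have [c [Q ->]] := mul_monomial (fun l => odd (i %/ 2 ^ l)) (fun l => odd (j %/ 2 ^ l)).
by have [l ->] := monomial_std Q; exists c, l.
Qed.

Lemma std_basis_comm i j : sign_commute (b i) (b j).
Proof. by rewrite !std_basisE; exact: monomial_comm. Qed.

Lemma std_basis_sqr i : exists c : bool, b i * b i = (-1) ^+ c.
Proof. by rewrite !std_basisE; exact: monomial_sqr. Qed.

Lemma std_basis_one : exists k, b k = 1.
Proof.
have [k E] := monomial_std pred0; exists k.
by rewrite -E /monomial big_pred0.
Qed.

(** By the dimension it is enough that the monomials span. Their span contains 1 and is stable under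
    left multiplication by the generators, hence it contains the algebra they generate. *)
Lemma std_basis_basis : agenv <<codom e>> = fullv -> \dim {:O} = (2 ^ p)%N ->
  basis_of fullv (std_basis e).
Proof.
move=> gen dimO; rewrite basisEdim size_tuple dimO leqnn andbT -gen.
have b_span j : b j \in <<std_basis e>>%VS by rewrite memv_span // mem_tnth.
apply: agenv_sub_modl.
  by rewrite -memvE; have [k <-] := std_basis_one.
apply/prodvP => x y xe ys; rewrite (coord_span xe) mulr_suml memv_suml // => i _.
rewrite -scalerAl memvZ // (coord_span ys) mulr_sumr memv_suml // => j _.
rewrite -scalerAr memvZ //.
have /codomP[i' ->] : (codom_tuple e)`_i \in codom e.
  by rewrite mem_nth // size_tuple.
rewrite -tnth_nth std_basisE.
have [c [Q ->]] := mul_gen_monomial (fun l => odd (j %/ 2 ^ l)) i'.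
have [l ->] := monomial_std Q.
by rewrite mulr_sign; case: ifP => _; rewrite ?memvN.
Qed.

End SignedMonomials.

(** * Prolongation of the Lie algebra *)

Section Prolongation.
Variables (R : realType) (p : nat) (O : falgType R) (e : 'I_p -> O).
Hypothesis e_sqr : forall i, exists c : bool, e i * e i = (-1) ^+ c.
Hypothesis e_anti : forall i j, i != j -> e i * e j = - (e j * e i).
Hypothesis e_gen : agenv <<codom e>> = fullv.
Hypothesis e_dim : \dim {:O} = (2 ^ p)%N.

Local Notation b := (tnth (std_basis e)).
Local Notation coordb := (coord (std_basis e)).

Lemma sum_coordb x : x = \sum_i coordb i x *: b i.
Proof.
have bas := std_basis_basis e_sqr e_anti e_gen e_dim.
rewrite {1}(coord_basis bas (memvf x)); apply: eq_bigr => i _.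
by rewrite (tnth_nth 0).
Qed.

Lemma coordb_sum (c : 'I_(2 ^ p) -> R) k : coordb k (\sum_i c i *: b i) = c k.
Proof.
have /basis_free fr := std_basis_basis e_sqr e_anti e_gen e_dim.
rewrite (eq_bigr (fun i => c i *: (std_basis e)`_i)) ?coord_sum_free // => i _.
by rewrite (tnth_nth 0).
Qed.

Lemma std_basis_inv i : exists y, y * b i = 1 /\ b i * y = 1.
Proof.
have [c E] := std_basis_sqr e_sqr e_anti i; exists ((-1) ^+ c * b i).
split; first by rewrite -mulrA E -signr_addb addbb.
by rewrite mulrA commr_sign -mulrA E -signr_addb addbb.
Qed.

(** The products F_i F_k F_j, for k varying, are the image of the standard basis under the bijection
    x |-> F_i x F_j. *)
Lemma sandwich_free i j (c : 'I_(2 ^ p) -> R) :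
  \sum_k c k *: (b i * b k * b j) = 0 -> forall k, c k = 0.
Proof.
have [y [yi iy]] := std_basis_inv i; have [z [zj jz]] := std_basis_inv j.
move=> E k; rewrite -(coordb_sum c k).
have -> : \sum_k c k *: b k = y * (\sum_k c k *: (b i * b k * b j)) * z.
  rewrite mulr_sumr mulr_suml; apply: eq_bigr => l _.
  by rewrite -scalerAr -scalerAl -!mulrA jz mulr1 mulrA yi mul1r.
by rewrite E mulr0 mul0r linear0.
Qed.

Lemma sandwich_neq0 i j k : b i * b k * b j != 0.
Proof.
apply/eqP => E; have := @sandwich_free i j (fun l => (l == k)%:R) _ k.
rewrite eqxx => H; suff /eqP : (1 : R) = 0 by rewrite oner_eq0.
apply: H; rewrite (bigD1 k) //= eqxx scale1r E add0r big1 // => l /negPf->.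
by rewrite scale0r.
Qed.

Lemma sandwich_swap i j k :
  exists c : bool, b j * b k * b i = (-1) ^+ c * (b i * b k * b j).
Proof.
have [c E] := std_basis_comm e_anti j k.
have [d E'] : sign_commute (b k * b j) (b i).
  apply/sign_commute_sym/sign_commuteM; exact: std_basis_comm.
by exists (c (+) d); rewrite E -[LHS]mulrA E' [LHS]mulrA -signr_addb !mulrA.
Qed.

(* Expand alpha_i as a combination of the F_i F_k and beta_i as a combination
   of the F_k F_i. Both terms are then multiples of F_i F_k F_j, since
   F_j F_k F_i = +- F_i F_k F_j, and the symmetry can be read off for each k. *)
Lemma bimodule_prolongation (alpha beta : 'I_(2 ^ p) -> O) u : b u = 1 ->
  (forall i j, alpha i * b j + b j * beta i = alpha j * b i + b i * beta j) ->
  alpha u + beta u = 0 ->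
  forall i j, alpha i * b j + b j * beta i = 0.
Proof.
move=> bu sym abu.
have inv_ i := cid (std_basis_inv i).
pose y i := sval (inv_ i).
have yb i : y i * b i = 1 by have [] := svalP (inv_ i).
have bY i : b i * y i = 1 by have [] := svalP (inv_ i).
pose A i k : R := coordb k (y i * alpha i); pose B i k : R := coordb k (beta i * y i).
have alphaE i : alpha i = \sum_k A i k *: (b i * b k).
  rewrite -[LHS]mul1r -(bY i) -mulrA {1}(sum_coordb (y i * alpha i)) mulr_sumr.
  by apply: eq_bigr => k _; rewrite scalerAr.
have betaE i : beta i = \sum_k B i k *: (b k * b i).
  rewrite -[LHS]mulr1 -(yb i) mulrA {1}(sum_coordb (beta i * y i)) mulr_suml.
  by apply: eq_bigr => k _; rewrite scalerAl.
pose t i k j := b i * b k * b j.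
pose sg i j k := sval (cid (sandwich_swap i j k)).
have sgE i j k : t j k i = ((-1) ^+ sg i j k : R) *: t i k j.
  rewrite /t (svalP (cid (sandwich_swap i j k))) scaler_sign -/(sg i j k).
  exact: mulr_sign.
have tauE i j : alpha i * b j + b j * beta i =
    \sum_k (A i k + (-1) ^+ sg i j k * B i k) *: t i k j.
  rewrite alphaE betaE mulr_suml mulr_sumr -big_split; apply: eq_bigr => k _ /=.
  by rewrite -scalerAl -scalerAr [b _ * (_ * _)]mulrA -/(t i k j) -/(t j k i) (sgE i j k)
    scalerA [RHS]scalerDl; congr (_ *: _ + _ *: _); rewrite mulrC.
have tauE' i j : alpha j * b i + b i * beta j =
    \sum_k ((-1) ^+ sg i j k * A j k + B j k) *: t i k j.
  rewrite alphaE betaE mulr_suml mulr_sumr -big_split; apply: eq_bigr => k _ /=.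
  by rewrite -scalerAl -scalerAr [b _ * (_ * _)]mulrA -/(t i k j) -/(t j k i) (sgE i j k)
    scalerA [RHS]scalerDl; congr (_ *: _ + _ *: _); rewrite mulrC.
have coef i j k : A i k + (-1) ^+ sg i j k * B i k =
    (-1) ^+ sg i j k * A j k + B j k.
  apply/eqP; rewrite -subr_eq0; apply/eqP; move: k.
  apply: (@sandwich_free i j).
  rewrite (eq_bigr _ (fun k _ => scalerBl _ _ _)) sumrB -tauE -tauE' sym.
  by rewrite subrr.
have t_neqN i k j : t i k j != - t i k j.
  by rewrite -addr_eq0 -mulr2n -scaler_nat scaler_eq0 pnatr_eq0 sandwich_neq0.
have plus i j k : t j k i = t i k j -> A i k + B i k = A j k + B j k.
  move=> E; have := coef i j k; have := sgE i j k; rewrite E.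
  case: (sg i j k); last by rewrite !mul1r.
  by rewrite expr1 scaleN1r => /eqP; rewrite (negPf (t_neqN _ _ _)).
have minus i j k : t j k i = - t i k j -> A i k - B i k = - (A j k - B j k).
  move=> E; have := coef i j k; have := sgE i j k; rewrite E.
  case: (sg i j k); first by rewrite expr1 => _ H; lra.
  by rewrite scale1r => /eqP; rewrite eq_sym (negPf (t_neqN _ _ _)).
(* The pair (l, k) always gives a plus sign, since F_k^2 is a sign and hence central. So
   [A l k + B l k] does not depend on l, and at l = u it is a coefficient of alpha_u + beta_u =
   0. *)
have sum0 i k : A i k + B i k = 0.
  have sq l : t k k l = t l k k.
    rewrite /t -[RHS]mulrA; have [c ->] := std_basis_sqr e_sqr e_anti k.
    by rewrite commr_sign.
  rewrite (plus _ _ _ (sq i)) -(plus _ _ _ (sq u)).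
  have : \sum_k (A u k + B u k) *: t u k u = 0.
    have abu' : alpha u * b u + b u * beta u = 0 by rewrite bu mulr1 mul1r.
    rewrite tauE in abu'; rewrite -[RHS]abu'; apply: eq_bigr => l _.
    congr (_ *: _); have := sgE u u l; case: (sg u u l); last by rewrite mul1r.
    by rewrite expr1 scaleN1r => /eqP; rewrite (negPf (t_neqN _ _ _)).
  by move/sandwich_free; apply.
move=> i j; rewrite tauE big1 // => k _.
have [E|E] : t j k i = t i k j \/ t j k i = - t i k j.
- have := sgE i j k; case: (sg i j k).
    by rewrite scaleN1r; right.
  by rewrite scale1r; left.
- have := coef i j k; have := sgE i j k; rewrite E; case: (sg i j k).
    by rewrite scaleN1r => /eqP; rewrite (negPf (t_neqN _ _ _)).
  by rewrite mul1r sum0 scale0r.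
(* F_i F_k F_j = +- F_l also anticommutes with F_i and F_j around F_k. *)
suff d0 : A i k - B i k = 0.
  have := sgE i j k; rewrite E; case: (sg i j k).
    by rewrite mulN1r d0 scale0r.
  by rewrite scale1r => /eqP; rewrite eq_sym (negPf (t_neqN _ _ _)).
have [c [l tl]] : exists (c : bool) l, t i k j = (-1) ^+ c * b l.
  have [c [l E1]] := std_basis_mul e_sqr e_anti i k.
  have [d [l' E2]] := std_basis_mul e_sqr e_anti l j.
  by exists (c (+) d), l'; rewrite /t E1 -mulrA E2 mulrA signr_addb.
have bl : b l = (-1) ^+ c * t i k j by rewrite tl signrMK.
have Ei : t l k i = - t i k l.
  have -> : t l k i = (-1) ^+ c * (t i k j * (b k * b i)).
    by rewrite [LHS]/t bl !mulrA.
  have -> : t i k l = (-1) ^+ c * (b i * b k * t i k j).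
    by rewrite [LHS]/t bl [LHS]mulrA (commr_sign (b i * b k) c) -[LHS]mulrA.
  have -> : t i k j * (b k * b i) = b i * b k * t j k i by rewrite /t !mulrA.
  by rewrite E !mulrN.
have Ej : t l k j = - t j k l.
  have -> : t l k j = (-1) ^+ c * (t i k j * (b k * b j)).
    by rewrite [LHS]/t bl !mulrA.
  have -> : t j k l = (-1) ^+ c * (b j * b k * t i k j).
    by rewrite [LHS]/t bl [LHS]mulrA (commr_sign (b j * b k) c) -[LHS]mulrA.
  have -> : b j * b k * t i k j = t j k i * (b k * b j) by rewrite /t !mulrA.
  by rewrite E mulNr mulrN opprK.
(* The differences A - B at i, j and l are pairwise opposite, so they vanish. *)
have d1 := minus _ _ _ E; have d2 := minus _ _ _ Ei; have d3 := minus _ _ _ Ej.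
by lra.
Qed.

End Prolongation.

(** * Tensors as bilinear maps *)

Section Bilinear.
Variables (R : realType) (n : nat).


Lemma mulmx_cV_inj (m : nat) (A B : 'M[R]_(m, n)) :
  (forall X : 'cV_n, A *m X = B *m X) -> A = B.
Proof.
move=> AB; apply/matrixP => i j.
by have := AB (delta_mx j 0); rewrite -!colE => /matrixP/(_ i 0); rewrite !mxE.
Qed.

Lemma tens_inj (T T' : tens R n) :
  (forall X Y : 'cV[R]_n, T X *m Y = T' X *m Y) -> T = T'.
Proof. by move=> TT'; apply/lfunP => X; apply: mulmx_cV_inj => Y. Qed.

Definition bilinear_tens (f : 'cV[R]_n -> 'cV[R]_n -> 'cV[R]_n) : tens R n :=
  linfun (fun X : 'cV[R]_n => \matrix_(i, j) f X (delta_mx j 0) i 0).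

Lemma bilinear_tensE f : (forall Y, linear (f^~ Y)) -> (forall X, linear (f X)) ->
  forall X Y, bilinear_tens f X *m Y = f X Y.
Proof.
move=> fl fr X Y.
pose g (X : 'cV[R]_n) : 'M[R]_n := \matrix_(i, j) f X (delta_mx j 0) i 0.
have gl : linear g.
  by move=> a x y; apply/matrixP => i j; rewrite !mxE fl !mxE.
pose gL := HB.pack_for {linear 'cV[R]_n -> 'M[R]_n} g
  (GRing.isLinear.Build _ _ _ _ g gl).
rewrite [bilinear_tens f X](lfunE gL) /= /g.
pose fL := HB.pack_for {linear 'cV[R]_n -> 'cV[R]_n} (f X)
  (GRing.isLinear.Build _ _ _ _ (f X) (fr X)).
rewrite -[f X Y]/(fL Y) [in RHS](matrix_sum_delta Y) linear_sum.
apply/matrixP => i k; rewrite (ord1 k) summxE mxE.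
by apply: eq_bigr => j _; rewrite big_ord1 linearZ /= !mxE mulrC.
Qed.

End Bilinear.

(** * Symmetric planar tensors with values in gl(m, O) + O *)

Section BlockModel.
Variables (R : realType) (p : nat) (O : falgType R) (e : 'I_p -> O).
Hypothesis e_sqr : forall i, exists c : bool, e i * e i = (-1) ^+ c.
Hypothesis e_anti : forall i j, i != j -> e i * e j = - (e j * e i).
Hypothesis e_gen : agenv <<codom e>> = fullv.
Hypothesis e_dim : \dim {:O} = (2 ^ p)%N.
Variable m : nat.

Local Notation b := (tnth (std_basis e)).
Local Notation coordb := (coord (std_basis e)).
Local Notation n := (2 ^ p * m)%N.
Local Notation blk := (block e m).

(** With its inverse [to_tuple], the identification of O^m with R^(k m) under which [block a] is
    left multiplication by a in each component. Matrix identities are then checked in O^m. *)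
Definition of_tuple (f : 'I_m -> O) : 'cV[R]_n :=
  (mxvec (\matrix_(i, j) coordb i (f j)))^T.

Definition to_tuple (X : 'cV[R]_n) : 'I_m -> O :=
  fun j => \sum_i vec_mx X^T i j *: b i.

Lemma of_tupleK f : to_tuple (of_tuple f) = f.
Proof.
apply: funext => j; rewrite /to_tuple /of_tuple trmxK mxvecK.
rewrite [RHS](sum_coordb e_sqr e_anti e_gen e_dim).
by apply: eq_bigr => i _; rewrite mxE.
Qed.

Lemma to_tupleK X : of_tuple (to_tuple X) = X.
Proof.
apply: trmx_inj; rewrite /of_tuple trmxK -[RHS]vec_mxK; congr mxvec.
apply/matrixP => i j; rewrite mxE.
exact: (coordb_sum e_sqr e_anti e_gen e_dim).
Qed.

Lemma to_tuple_linear a X Y q :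
  to_tuple (a *: X + Y) q = a *: to_tuple X q + to_tuple Y q.
Proof.
rewrite /to_tuple scaler_sumr -big_split; apply: eq_bigr => i _ /=.
by rewrite !linearP /= !mxE scalerDl scalerA.
Qed.

Lemma block_of_tuple a f : blk a *m of_tuple f = of_tuple (fun q => a * f q).
Proof.
rewrite /of_tuple blockE; congr (mxvec _)^T; apply/matrixP => i j.
rewrite !mxE [in RHS](sum_coordb e_sqr e_anti e_gen e_dim (f j)) mulr_sumr linear_sum.
by apply: eq_bigr => k _; rewrite !mxE -scalerAr linearZ /= mulrC.
Qed.

Lemma to_tuple_block a X q : to_tuple (blk a *m X) q = a * to_tuple X q.
Proof. by rewrite -{1}(to_tupleK X) block_of_tuple of_tupleK. Qed.

Lemma to_tuple_inj X Y : (forall q, to_tuple X q = to_tuple Y q) -> X = Y.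
Proof.
by move=> XY; rewrite -(to_tupleK X) -(to_tupleK Y); congr of_tuple; apply: funext.
Qed.

Lemma to_tuple0 q : to_tuple 0 q = 0.
Proof.
by rewrite /to_tuple big1 // => i _; rewrite linear0 linear0 mxE scale0r.
Qed.

Lemma to_tupleD X Y q : to_tuple (X + Y) q = to_tuple X q + to_tuple Y q.
Proof. by rewrite -[X]scale1r to_tuple_linear !scale1r. Qed.

Lemma to_tupleZ a X q : to_tuple (a *: X) q = a *: to_tuple X q.
Proof. by rewrite -[a *: X]addr0 to_tuple_linear to_tuple0 addr0. Qed.

Lemma block_linear a x y : blk (a *: x + y) = a *: blk x + blk y.
Proof.
apply: mulmx_cV_inj => X; apply: to_tuple_inj => q.
rewrite mulmxDl -scalemxAl to_tuple_linear !to_tuple_block.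
by rewrite mulrDl scalerAl.
Qed.

Lemma blockM x y : blk (x * y) = blk x *m blk y.
Proof.
apply: mulmx_cV_inj => X; apply: to_tuple_inj => q.
by rewrite -mulmxA !to_tuple_block mulrA.
Qed.

Lemma block1 : blk 1 = 1%:M.
Proof.
apply: mulmx_cV_inj => X; apply: to_tuple_inj => q.
by rewrite to_tuple_block mul1r mul1mx.
Qed.

Lemma block0 : blk 0 = 0.
Proof.
apply: mulmx_cV_inj => X; apply: to_tuple_inj => q.
by rewrite to_tuple_block mul0r mul0mx to_tuple0.
Qed.

Lemma blockD x y : blk (x + y) = blk x + blk y.
Proof. by rewrite -[x]scale1r block_linear !scale1r. Qed.

Lemma blockZ a x : blk (a *: x) = a *: blk x.
Proof. by rewrite -[a *: x]addr0 block_linear block0 addr0. Qed.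

Lemma blockB x y : blk (x - y) = blk x - blk y.
Proof. by rewrite -[- y]scaleN1r blockD blockZ scaleN1r. Qed.

Definition emb (x : O) (q : 'I_m) : 'cV[R]_n :=
  of_tuple (fun j => if j == q then x else 0).

Lemma to_tuple_emb x q j : to_tuple (emb x q) j = if j == q then x else 0.
Proof. by rewrite of_tupleK. Qed.

Lemma block_emb a x q : blk a *m emb x q = emb (a * x) q.
Proof.
apply: to_tuple_inj => j; rewrite to_tuple_block !to_tuple_emb.
by case: ifP; rewrite ?mulr0.
Qed.

Lemma emb_linear a x y q : emb (a *: x + y) q = a *: emb x q + emb y q.
Proof.
apply: to_tuple_inj => j; rewrite to_tuple_linear !to_tuple_emb.
by case: ifP; rewrite ?scaler0 ?addr0.
Qed.

Lemma embD x y q : emb (x + y) q = emb x q + emb y q.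
Proof. by rewrite -[x]scale1r emb_linear !scale1r. Qed.

Lemma sum_emb X : X = \sum_q \sum_i vec_mx X^T i q *: emb (b i) q.
Proof.
apply: to_tuple_inj => j.
pose L := fun X : 'cV[R]_n => to_tuple X j.
have Lsum (I : Type) (s : seq I) (F : I -> 'cV[R]_n) :
    L (\sum_(i <- s) F i) = \sum_(i <- s) L (F i).
  by apply: (big_morph L (fun X Y => to_tupleD X Y j) (to_tuple0 j)).
rewrite -[RHS]/(L _) Lsum (bigD1 j) //= [X in _ + X]big1 ?addr0 => [|q qj].
  by rewrite Lsum; apply: eq_bigr => i _; rewrite /L to_tupleZ to_tuple_emb eqxx.
rewrite Lsum big1 // => i _.
by rewrite /L to_tupleZ to_tuple_emb eq_sym (negPf qj) scaler0.
Qed.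

Definition commutesO (B : 'M[R]_n) : Prop :=
  forall i, B *m blk (e i) = blk (e i) *m B.

Lemma commutesO_block B a : commutesO B -> B *m blk a = blk a *m B.
Proof.
move=> Be; rewrite (sum_coordb e_sqr e_anti e_gen e_dim a).
have P0 : B *m blk 0 = blk 0 *m B by rewrite block0 mulmx0 mul0mx.
elim/big_ind : _ => // [x y xB yB|i _].
  by rewrite blockD mulmxDr mulmxDl xB yB.
rewrite blockZ -scalemxAr -scalemxAl; congr (_ *: _).
rewrite std_basisE /monomial.
apply: (big_ind (fun x => B *m blk x = blk x *m B)) => [|x y xB yB|k _];
  last exact: Be.
  by rewrite block1 mul1mx mulmx1.
by rewrite blockM mulmxA xB -mulmxA yB mulmxA.
Qed.

(** The explicit form gl(m, O) + O of the Lie algebra; [lie_cliffG] identifies it with the tangent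
    space of G at 1. *)
Definition glO : set 'M[R]_n :=
  [set A | exists a B, commutesO B /\ A = blk a + B].

Lemma commutesO_linear c A B : commutesO A -> commutesO B -> commutesO (c *: A + B).
Proof.
move=> Ae Be i; rewrite mulmxDl mulmxDr -scalemxAl -scalemxAr.
by rewrite Ae Be.
Qed.

Lemma glO_linear c A B : glO A -> glO B -> glO (c *: A + B).
Proof.
move=> [a [A' [A'e ->]]] [d [B' [B'e ->]]]; exists (c *: a + d), (c *: A' + B').
split; first exact: commutesO_linear.
by rewrite block_linear scalerDr addrACA.
Qed.

(** The first two conditions define the first prolongation of gl(m, O) + O. In the third, no
    regularity of a in X is asked, as planarity of curves yields none. *)
Record planar_prolongation (T : tens R n) : Prop := {
  prol_sym : forall X Y, T X *m Y = T Y *m X;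
  prol_glO : forall X, glO (T X);
  prol_planar : forall X, exists a, T X *m X = blk a *m X }.

Lemma planar_prolongation_linear c T T' : planar_prolongation T ->
  planar_prolongation T' -> planar_prolongation (c *: T + T').
Proof.
move=> [s1 g1 p1] [s2 g2 p2]; split.
- move=> X Y; rewrite !add_lfunE !scale_lfunE !mulmxDl -!scalemxAl.
  by rewrite s1 s2.
- by move=> X; rewrite add_lfunE scale_lfunE; apply: glO_linear.
move=> X; have [a aE] := p1 X; have [d dE] := p2 X; exists (c *: a + d).
rewrite add_lfunE scale_lfunE mulmxDl -scalemxAl aE dE.
by rewrite block_linear mulmxDl -scalemxAl.
Qed.

Lemma polarize (T : tens R n) (X Y : 'cV[R]_n) :
  (forall X Y : 'cV[R]_n, T X *m Y = T Y *m X) ->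
  T (X + Y) *m (X + Y) = T X *m X + T Y *m Y + 2 *: (T X *m Y).
Proof.
move=> sT; have -> : T (X + Y) = T X + T Y by rewrite linearD.
rewrite mulmxDr !mulmxDl (sT Y X).
rewrite scaler_nat mulr2n.
set A := T X *m X; set B := T X *m Y; set C := T Y *m Y.
by rewrite [B + C]addrC addrACA.
Qed.

Lemma prolongation_vanish T : planar_prolongation T ->
  (forall q, T (emb 1 q) *m emb 1 q = 0) -> T = 0.
Proof.
move=> [sT gT pT] T1.
(* T(z eps_q, z eps_q) lies in O eps_q for every z; polarization extends this to pairs. *)
have on_line q j x y : j != q -> to_tuple (T (emb x q) *m emb y q) j = 0.
  move=> jq.
  have sq z : to_tuple (T (emb z q) *m emb z q) j = 0.
    have [a ->] := pT (emb z q).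
    by rewrite to_tuple_block to_tuple_emb (negPf jq) mulr0.
  have := sq (x + y).
  rewrite embD polarize // !to_tupleD !sq !add0r to_tupleZ => /eqP.
  by rewrite scaler_eq0 pnatr_eq0 => /eqP.
have diag q i j : T (emb (b i) q) *m emb (b j) q = 0.
  have glT k := cid (gT (emb (b k) q)).
  pose alpha k := sval (glT k).
  have glT2 k := cid (svalP (glT k)).
  pose B k := sval (glT2 k).
  have [Bc TB] : (forall k, commutesO (B k)) /\
      (forall k, T (emb (b k) q) = blk (alpha k) + B k).
    by split=> k; have [] := svalP (glT2 k).
  pose beta k := to_tuple (B k *m emb 1 q) q.
  (* [B k] is O-linear and, by [on_line], preserves O eps_q; a left O-linear endomorphism of O is a
     right multiplication. *)
  have BE k x : B k *m emb x q = emb (x * beta k) q.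
    have -> : emb x q = blk x *m emb 1 q by rewrite block_emb mulr1.
    rewrite mulmxA commutesO_block // -mulmxA -block_emb; congr (_ *m _).
    apply: to_tuple_inj => l; rewrite to_tuple_emb; case: eqVneq => [->//|lq].
    have := on_line q l (b k) 1 lq; rewrite TB mulmxDl to_tupleD block_emb.
    by rewrite to_tuple_emb (negPf lq) add0r.
  have TE k l : T (emb (b k) q) *m emb (b l) q =
      emb (alpha k * b l + b l * beta k) q.
    rewrite TB mulmxDl block_emb BE.
    by rewrite embD.
  have emb_inj x y : emb x q = emb y q -> x = y.
    by move=> /(congr1 (to_tuple^~ q)); rewrite !to_tuple_emb eqxx.
  have [u bu] := std_basis_one e.
  have emb0 : emb 0 q = 0.
    by apply: to_tuple_inj => l; rewrite to_tuple_emb to_tuple0; case: ifP.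
  rewrite TE -[in RHS]emb0; congr (emb _ q); move: i j.
  apply: (@bimodule_prolongation _ _ _ _ e_sqr e_anti e_gen e_dim alpha beta u bu)
    => [k l|].
    by apply: emb_inj; rewrite -(TE k l) -(TE l k); exact: sT.
  by apply: emb_inj; rewrite emb0 -(T1 q) -bu TE bu mulr1 mul1r.
have off q r i j : r != q -> T (emb (b i) q) *m emb (b j) r = 0.
  move=> rq; set X := emb (b i) q; set Y := emb (b j) r; set Z := T X *m Y.
  have [f fE] := pT (X + Y); have [g gE] := pT (X - Y).
  rewrite polarize // !diag !add0r -/Z in fE.
  have {}gE : - (2 *: Z) = blk g *m (X - Y).
    have TN : T (- Y) = - T Y by rewrite linearN.
    rewrite -gE polarize // TN mulNmx !mulmxN opprK !diag !add0r.
    by rewrite scalerN.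
  have fX l : to_tuple (2 *: Z) l =
      f * (if l == q then b i else 0) + f * (if l == r then b j else 0).
    by rewrite fE mulmxDr to_tupleD !to_tuple_block !to_tuple_emb.
  have gX l : to_tuple (2 *: Z) l =
      - (g * (if l == q then b i else 0)) + g * (if l == r then b j else 0).
    rewrite -[2 *: Z]opprK gE mulmxBr opprB addrC -[- (blk g *m X)]scaleN1r.
    by rewrite to_tuple_linear !to_tuple_block !to_tuple_emb scaleN1r.
  have f0 : f = 0.
    have [z [zb bz]] := std_basis_inv e_sqr e_anti i.
    have [w [wb bw]] := std_basis_inv e_sqr e_anti j.
    have h1 : f = - g.
      have := fX q; rewrite gX eqxx eq_sym (negPf rq) !mulr0 !addr0 => E.
      by rewrite -[f]mulr1 -bz mulrA -E mulNr -mulrA bz mulr1.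
    have h2 : f = g.
      have := fX r; rewrite gX eqxx (negPf rq) !mulr0 oppr0 !add0r => E.
      by rewrite -[f]mulr1 -bw mulrA -E -mulrA bw mulr1.
    apply/eqP; have : f + f == 0 by rewrite {2}h2 h1 addNr.
    by rewrite -mulr2n -scaler_nat scaler_eq0 pnatr_eq0.
  have : 2 *: Z = 0.
    by apply: to_tuple_inj => l; rewrite fX f0 !mul0r add0r to_tuple0.
  by move/eqP; rewrite scaler_eq0 pnatr_eq0 => /eqP.
apply: tens_inj => X Y; rewrite zero_lfunE mul0mx.
have -> : T X = \sum_q \sum_i vec_mx X^T i q *: T (emb (b i) q).
  rewrite {1}(sum_emb X) linear_sum; apply: eq_bigr => q _.
  by rewrite linear_sum; apply: eq_bigr => i _; rewrite linearZ.
rewrite (sum_emb Y) mulmx_suml big1 // => q _; rewrite mulmx_suml big1 // => i _.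
rewrite -scalemxAl mulmx_sumr big1 ?scaler0 // => r _.
rewrite mulmx_sumr big1 // => j _; rewrite -scalemxAr.
by have [->|rq] := eqVneq r q; rewrite ?diag ?off ?scaler0.
Qed.

Definition lam (nu : 'I_m -> O) (X : 'cV[R]_n) : O := \sum_q to_tuple X q * nu q.

Lemma lam_linear nu a X Y : lam nu (a *: X + Y) = a *: lam nu X + lam nu Y.
Proof.
rewrite /lam scaler_sumr -big_split; apply: eq_bigr => q _ /=.
by rewrite to_tuple_linear mulrDl scalerAl.
Qed.

Lemma lam_block nu a X : lam nu (blk a *m X) = a * lam nu X.
Proof.
rewrite /lam mulr_sumr; apply: eq_bigr => q _.
by rewrite to_tuple_block mulrA.
Qed.

Definition proj_tens (nu : 'I_m -> O) : tens R n :=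
  bilinear_tens (fun X Y => blk (lam nu X) *m Y + blk (lam nu Y) *m X).

Lemma proj_tensE nu X Y :
  proj_tens nu X *m Y = blk (lam nu X) *m Y + blk (lam nu Y) *m X.
Proof.
apply: bilinear_tensE => [{}Y a U V|{}X a U V] /=.
  rewrite lam_linear block_linear mulmxDl -scalemxAl mulmxDr -scalemxAr.
  by rewrite scalerDr addrACA.
rewrite lam_linear block_linear mulmxDl -scalemxAl mulmxDr -scalemxAr.
by rewrite scalerDr addrACA.
Qed.

(** For fixed X, the term lam(X) Y is the action of an element of O, and lam(Y) X is O-linear in Y
    because lam is. *)
Lemma proj_tens_planar nu : planar_prolongation (proj_tens nu).
Proof.
split=> [X Y|X|X]; first by rewrite !proj_tensE addrC.
  exists (lam nu X), (proj_tens nu X - blk (lam nu X)); split; last by rewrite addrC subrK.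
  move=> i; apply: mulmx_cV_inj => Y; rewrite -!mulmxA !mulmxBl !mulmxBr.
  rewrite !proj_tensE [in LHS]addrC addKr [X in blk (e i) *m X - _]addrC.
  by rewrite mulmxDr addrK lam_block blockM mulmxA.
exists (2 *: lam nu X); rewrite proj_tensE blockZ -scalemxAl.
by rewrite scaler_nat mulr2n.
Qed.

Lemma lam_emb nu x q : lam nu (emb x q) = x * nu q.
Proof.
rewrite /lam (bigD1 q) //= to_tuple_emb eqxx big1 ?addr0 // => j jq.
by rewrite to_tuple_emb (negPf jq) mul0r.
Qed.

Lemma proj_tens_linear a nu nu' :
  proj_tens (fun q => a *: nu q + nu' q) = a *: proj_tens nu + proj_tens nu'.
Proof.
have lamE X : lam (fun q => a *: nu q + nu' q) X = a *: lam nu X + lam nu' X.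
  rewrite /lam scaler_sumr -big_split; apply: eq_bigr => q _ /=.
  by rewrite mulrDr scalerAr.
apply: tens_inj => X Y; rewrite add_lfunE scale_lfunE mulmxDl -scalemxAl.
rewrite !proj_tensE !lamE !block_linear !mulmxDl -!scalemxAl scalerDr.
by rewrite addrACA.
Qed.

Lemma proj_tens_diag nu q :
  proj_tens nu (emb 1 q) *m emb 1 q = emb (2 *: nu q) q.
Proof.
rewrite proj_tensE lam_emb block_emb !mul1r mulr1.
by rewrite -embD scaler_nat mulr2n.
Qed.

Lemma proj_tens_eq0 nu : proj_tens nu = 0 -> nu = fun=> 0.
Proof.
move=> E; apply: funext => q; have := proj_tens_diag nu q.
rewrite E zero_lfunE mul0mx => /(congr1 (to_tuple^~ q)).
rewrite to_tuple0 to_tuple_emb eqxx => /esym/eqP.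
by rewrite scaler_eq0 pnatr_eq0 => /eqP.
Qed.

Lemma planar_prolongationP T : planar_prolongation T -> exists nu, T = proj_tens nu.
Proof.
move=> pT; have aE q := cid (prol_planar pT (emb 1 q)).
(* The half compensates S_nu(eps_q, eps_q) = 2 nu_q eps_q. *)
pose nu q := 2^-1 *: sval (aE q); exists nu.
apply/eqP; rewrite -subr_eq0 -addrC -scaleN1r; apply/eqP.
apply: prolongation_vanish.
  by apply: planar_prolongation_linear => //; exact: proj_tens_planar.
move=> q; rewrite add_lfunE scale_lfunE mulmxDl -scalemxAl proj_tens_diag.
rewrite (svalP (aE q)) block_emb mulr1 /nu scalerA divff ?pnatr_eq0 //.
by rewrite scale1r scaleN1r addNr.
Qed.

End BlockModel.

(** * Derivatives of matrix products *)

Section MatrixCalculus.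
Variables (R : realType) (V : normedModType R).

Lemma is_derive_mulmx (m n p : nat) (M : V -> 'M[R]_(m, n)) (N : V -> 'M[R]_(n, p))
    (x v : V) dM dN :
  is_derive x v M dM -> is_derive x v N dN ->
  is_derive x v (fun y => M y *m N y) (dM *m N x + M x *m dN).
Proof.
move=> Md Nd; apply: is_derive_mx => i j.
have -> : (fun y => (M y *m N y) i j) =
    \sum_k (fun y => M y i k) * (fun y => N y k j).
  by apply: funext => y; rewrite mxE fct_sumE.
have Md' k := is_derive_coord i k Md.
have Nd' k := is_derive_coord k j Nd.
apply: is_derive_eq; rewrite !mxE -big_split /=; apply: eq_bigr => k _.
by rewrite addrC /GRing.scale /=; congr (_ + _); rewrite mulrC.
Qed.

Lemma is_derive_sumZ (m n k : nat) (c : 'I_k -> V -> R) (A : 'I_k -> 'M[R]_(m, n))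
    (x v : V) (dc : 'I_k -> R) :
  (forall i, is_derive x v (c i) (dc i)) ->
  is_derive x v (fun y => \sum_i c i y *: A i) (\sum_i dc i *: A i).
Proof.
move=> cd; apply: is_derive_mx => i j.
have -> : (fun y => (\sum_l c l y *: A l) i j) = \sum_l (A l i j *: c l).
  apply: funext => y; rewrite summxE fct_sumE; apply: eq_bigr => l _.
  by rewrite mxE mulrC.
apply: is_derive_eq; rewrite summxE; apply: eq_bigr => l _.
by rewrite mxE mulrC.
Qed.

End MatrixCalculus.

(** * The Lie algebra of GL(m, O)GL(1, O) *)

Section LieAlgebra.
Variables (R : realType) (p : nat) (O : falgType R) (e : 'I_p -> O).
Hypothesis e_sqr : forall i, exists c : bool, e i * e i = (-1) ^+ c.
Hypothesis e_anti : forall i j, i != j -> e i * e j = - (e j * e i).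
Hypothesis e_gen : agenv <<codom e>> = fullv.
Hypothesis e_dim : \dim {:O} = (2 ^ p)%N.
Variable m : nat.

Local Notation b := (tnth (std_basis e)).
Local Notation n := (2 ^ p * m)%N.
Local Notation blk := (block e m).
Local Notation blkD := (blockD e_sqr e_anti e_gen e_dim).
Local Notation blkZ := (blockZ e_sqr e_anti e_gen e_dim).
Local Notation blkM := (blockM e_sqr e_anti e_gen e_dim).
Local Notation blk1 := (block1 e_sqr e_anti e_gen e_dim).
Local Notation blk0 := (block0 e_sqr e_anti e_gen e_dim).

Lemma block_sum (I : Type) (s : seq I) (F : I -> O) :
  blk (\sum_(i <- s) F i) = \sum_(i <- s) blk (F i).
Proof. exact: (big_morph blk (@blkD m) (@blk0 m)). Qed.

(** The coefficients of an element of O are entries of its value on the unit of one block, so they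
    are derivable with N. The derivative is then a combination of the same fixed matrices F_i. *)
Lemma range_block_derive (V : normedModType R) (N : V -> 'M[R]_n) (x v : V) :
  derivable N x v -> (\near x, cliffA e m (N x)) -> cliffA e m ('D_v N x).
Proof.
move=> Nd Nb; have [m0|m0] := posnP m.
  exists 0 => //; apply/matrixP => -[i ip]; exfalso.
  by move: ip; rewrite m0 muln0.
pose q := Ordinal m0.
pose c i y := (N y *m emb e 1 q) (mxvec_index i q) 0.
have cE y : cliffA e m (N y) -> N y = \sum_i c i y *: blk (b i).
  case=> a _ Na; rewrite -Na; have -> : a = \sum_i c i y *: b i.
    have := to_tuple_block e_sqr e_anti e_gen e_dim a (emb e 1 q) q.
    rewrite to_tuple_emb // eqxx mulr1 => <-; rewrite /to_tuple.
    by apply: eq_bigr => i _; rewrite /c -Na !mxE.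
  by rewrite block_sum; apply: eq_bigr => i _; rewrite blkZ.
have cd i : is_derive x v (c i) (('D_v N x *m emb e 1 q) (mxvec_index i q) 0).
  apply: is_derive_coord.
  have := is_derive_mulmx (derivableP Nd) (is_derive_cst (emb e 1 q) x v).
  by rewrite mulmx0 addr0.
have := is_derive_sumZ (fun i => blk (b i)) cd.
move/(near_eq_is_derive (g := N)) => [].
  by apply: filterS Nb => y /cE ->.
move=> _ ->; exists (\sum_i ('D_v N x *m emb e 1 q) (mxvec_index i q) 0 *: b i) => //.
by rewrite block_sum; apply: eq_bigr => i _; rewrite blkZ.
Qed.

(* The average of A over conjugation by the standard basis commutes with O, and
   differs from A by the average of [A, F] F^-1, which lies in O. *)
Lemma bracket_glO (A : 'M[R]_n) :
  (forall x, cliffA e m (A *m blk x - blk x *m A)) -> glO e A.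
Proof.
move=> Abr.
have inv_ i := cid (std_basis_inv e_sqr e_anti i).
pose y i := sval (inv_ i).
have yb i : y i * b i = 1 by have [] := svalP (inv_ i).
have bY i : b i * y i = 1 by have [] := svalP (inv_ i).
pose k : R := (2 ^ p)%N%:R.
have k0 : k != 0 by rewrite pnatr_eq0 expn_eq0.
pose S := \sum_i blk (b i) *m A *m blk (y i).
have Sc : commutesO e S.
  move=> l.
  have [c [s sE]] : exists (c : 'I_(2 ^ p) -> bool) (s : 'I_(2 ^ p) -> 'I_(2 ^ p)),
      forall i, e l * b i = (-1) ^+ c i * b (s i).
    have mul_l i : exists cj : bool * 'I_(2 ^ p), e l * b i = (-1) ^+ cj.1 * b cj.2.
      rewrite std_basisE.
      have [c [Q ->]] := mul_gen_monomial e_sqr e_anti (fun l => odd (i %/ 2 ^ l)) l.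
      by have [j ->] := monomial_std e Q; exists (c, j).
    exists (fun i => (sval (cid (mul_l i))).1), (fun i => (sval (cid (mul_l i))).2).
    by move=> i; exact: (svalP (cid (mul_l i))).
  have [z zl] : exists z, z * e l = 1.
    have [d E] := e_sqr l; exists ((-1) ^+ d * e l).
    by rewrite -mulrA E -signr_addb addbb.
  have bN i j : b i = b j \/ b i = - b j -> i = j.
    have co (i' : 'I_(2 ^ p)) : coord (std_basis e) i (b i') = (i == i')%:R.
      rewrite -(coordb_sum e_sqr e_anti e_gen e_dim (fun i => (i == i')%:R)).
      congr (coord _ _ _); rewrite (bigD1 i') //= eqxx scale1r big1 ?addr0 //.
      by move=> a /negPf->; rewrite scale0r.
    case=> /(congr1 (coord (std_basis e) i)); rewrite ?linearN /= !co eqxx;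
      case: eqVneq => // _ /eqP; rewrite ?oppr0 oner_eq0 //.
  have s_inj : injective s.
    move=> i j sij; apply: bN.
    have {}sij : e l * b i = (-1) ^+ (c i (+) c j) * (e l * b j).
      by rewrite !sE sij mulrA -signr_addb -addbA addbb addbF.
    have : b i = (-1) ^+ (c i (+) c j) * b j.
      rewrite -[LHS]mul1r -zl -mulrA sij mulrA commr_sign -mulrA.
      by rewrite [z * _]mulrA zl mul1r.
    by case: (_ (+) _) => ->; rewrite ?expr1 ?mulN1r ?mul1r; [right|left].
  have yE i : y (s i) * e l = (-1) ^+ c i * y i.
    rewrite -[LHS]mulr1 -{1}(bY i) mulrA -[_ * _ * b i]mulrA sE.
    by rewrite mulrA commr_sign -[_ * _ * b (s i)]mulrA yb mulr1.
  rewrite /S mulmx_suml mulmx_sumr (reindex_inj s_inj); apply: eq_bigr => i _ /=.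
  rewrite -mulmxA -blkM yE !mulmxA -blkM sE.
  case: (c i); last by rewrite expr0 !mul1r.
  rewrite expr1 !mulN1r -[- y i]scaleN1r -[- b (s i)]scaleN1r !blkZ.
  by rewrite -!scalemxAl -scalemxAr.
have SA : cliffA e m (k *: A - S).
  have -> : k *: A - S = \sum_i (A *m blk (b i) - blk (b i) *m A) *m blk (y i).
    transitivity (\sum_i (A - blk (b i) *m A *m blk (y i))).
      by rewrite sumrB sumr_const card_ord scaler_nat.
    by apply: eq_bigr => i _; rewrite mulmxBl -(mulmxA A) -blkM bY blk1 mulmx1.
  have d_ i := cid2 (Abr (b i)).
  exists (\sum_i sval (d_ i) * y i) => //; rewrite block_sum.
  apply: eq_bigr => i _; rewrite blkM.
  by have -> := s2valP' (d_ i).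
case: SA => d _ dE; exists (k^-1 *: d), (k^-1 *: S); split.
  rewrite -[k^-1 *: S]addr0; apply: commutesO_linear => // i.
  by rewrite mulmx0 mul0mx.
rewrite blkZ dE -scalerDr subrK scalerA mulVf ?scale1r //.
Qed.

Record normalizesO (g : 'M[R]_n) : Prop := {
  norm_unit : g \in unitmx;
  norm_conj : forall x, cliffA e m (g *m blk x *m invmx g);
  norm_conjV : forall x, cliffA e m (invmx g *m blk x *m g) }.

Lemma normalizesV g : normalizesO g -> normalizesO (invmx g).
Proof.
by case=> gu gc gcV; split; [rewrite unitmx_inv|rewrite invmxK|rewrite invmxK].
Qed.

Lemma invmx_eq (k : nat) (M N : 'M[R]_k) : M *m N = 1%:M -> invmx M = N.
Proof.
move=> MN; have [Mu _] := mulmx1_unit MN.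
by rewrite -[RHS]mul1mx -(mulVmx Mu) -mulmxA MN mulmx1.
Qed.

Lemma cliffG_normalizes g : cliffG e m g -> normalizesO g.
Proof.
case=> B [C [[Bu Bc] [a au ->] ->]].
have aVa : blk a *m blk a^-1 = 1%:M by rewrite -blkM divrr // blk1.
have Cu : blk a \in unitmx by have [] := mulmx1_unit aVa.
have Bc' := commutesO_block e_sqr e_anti e_gen e_dim _ Bc.
have gu : B *m blk a \in unitmx by rewrite unitmx_mul Bu.
have gV : invmx (B *m blk a) = blk a^-1 *m invmx B.
  by apply: invmx_eq; rewrite mulmxA -(mulmxA B) aVa mulmx1 mulmxV.
split=> // x; rewrite gV.
  exists (a * x * a^-1) => //; rewrite -[RHS]mulmxA !mulmxA.
  rewrite -(mulmxA B) -blkM -(mulmxA B) -blkM Bc' -mulmxA mulmxV // mulmx1 //.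
exists (a^-1 * x * a) => //; rewrite !blkM.
rewrite -!mulmxA; congr (_ *m _).
by rewrite [blk x *m (B *m _)]mulmxA -Bc' -mulmxA mulKmx.
Qed.

Lemma lie_cliffG_sub : lie (cliffG e m) `<=` glO e (m := m).
Proof.
move=> A [W [c [[Wo W0 cs cG c0] ->]]].
have cd : is_derive (0 : R) (1 : R) c (derive1 c 0).
  by rewrite derive1E; apply: derivableP; exact: Ck_derivable (cs 1) W0.
apply: bracket_glO => x.
pose N h := c h *m blk x *m invmx (c h).
have cu h : W h -> c h \in unitmx by move=> /cG/cliffG_normalizes[].
have N1 : Ck 1 W N.
  have cV : Ck 1 W (fun h => invmx (c h)) := Ck_invmx Wo cu (cs 1).
  have cx : Ck 1 W (fun h => c h *m blk x).
    exact: (Ck_mulmx Wo (cs 1) (Ck_cst 1 W (blk x))).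
  exact: (Ck_mulmx Wo cx cV).
have Nd : derivable N 0 1 by exact: Ck_derivable N1 W0.
have : cliffA e m ('D_1 N 0).
  apply: range_block_derive => //.
  have := open_nbhs_nbhs (conj Wo W0); apply: filterS => h Wh.
  by have [_ + _] := cliffG_normalizes (cG h Wh); apply.
have l1 := is_derive_mulmx (derivableP Nd) cd.
have l2 := is_derive_mulmx cd (is_derive_cst (blk x) (0 : R) (1 : R)).
have : {near (0 : R), (fun h => N h *m c h) =1 (fun h => c h *m blk x)}.
  have := open_nbhs_nbhs (conj Wo W0); apply: filterS => h Wh.
  by rewrite /N mulmxKV // cu.
move/near_eq_derive => /(_ 1); case: l1 => _ ->; case: l2 => _ ->.
rewrite mulmx0 addr0 {2}/N c0 invmx1 mulmx1 mul1mx mulmx1 => E.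
by rewrite -E addrK.
Qed.

Lemma block_unit (x : O) : block e 1 x \in unitmx -> x \is a GRing.unit.
Proof.
move=> xu; pose y := to_tuple e (invmx (block e 1 x) *m emb e 1 0) 0.
have xy : x * y = 1.
  rewrite /y -(to_tuple_block e_sqr e_anti e_gen e_dim) mulKVmx //.
  by rewrite (to_tuple_emb e_sqr e_anti e_gen e_dim) eqxx.
have : block e 1 y *m block e 1 x = 1%:M by apply: mulmx1C; rewrite -blkM xy blk1.
rewrite -blkM -(blk1 1) => /(congr1 (fun A => to_tuple e (A *m emb e 1 0) 0)).
rewrite !(to_tuple_block e_sqr e_anti e_gen e_dim).
rewrite (to_tuple_emb e_sqr e_anti e_gen e_dim) eqxx !mulr1 => yx.
by apply/unitrP; exists y.
Qed.

Lemma open_unitmx (k : nat) (M : R -> 'M[R]_k) : Ck 0 setT M ->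
  open [set h | M h \in unitmx].
Proof.
move=> Mc.
have -> : [set h | M h \in unitmx] = (fun h => \det (M h)) @^-1` [set x | x != 0].
  by apply/seteqP; split => h /=; rewrite unitmxE unitfE.
apply: open_comp; last exact: open_neq.
by move=> h _; apply: (@Ck_continuous _ _ _ 0 setT) => //; apply: Ck_det => //; exact: openT.
Qed.

Lemma glO_lie : glO e (m := m) `<=` lie (cliffG e m).
Proof.
move=> A [a [B [Bc ->]]].
pose aff k (M : 'M[R]_k) (h : R) : 'M[R]_k := 1%:M + h *: M.
have affs k (M : 'M[R]_k) r (W : set R) : open W -> Ck r W (aff k M).
  move=> Wo; apply: CkD => //; first exact: Ck_cst.
  apply/(Ck_mxP _ _ Wo) => i j.
  apply: (@eq_Ck R R R r W (fun h : R => h * M i j)) => // [h _|]; first by rewrite mxE.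
  by apply: CkM => //; [exact: Ck_id|exact: Ck_cst].
have affE k h : block e k (1 + h *: a) = aff _ (block e k a) h.
  by rewrite blkD blkZ blk1.
pose W := [set h | aff _ B h \in unitmx] `&` [set h | aff _ (block e 1 a) h \in unitmx].
have Wo : open W by apply: openI; apply: open_unitmx; apply: affs; exact: openT.
pose c h := aff _ B h *m aff _ (blk a) h.
have aff0 k (M : 'M[R]_k) : aff k M 0 = 1%:M by rewrite /aff scale0r addr0.
exists W, c; split; first split => //.
- by split; rewrite /= aff0 unitmx1.
- by move=> r; apply: Ck_mulmx => //; exact: affs.
- move=> h [h1 h2]; exists (aff _ B h), (aff _ (blk a) h); split => //.
    split => // i; rewrite /aff mulmxDl mulmxDr mul1mx mulmx1 -scalemxAl -scalemxAr.
    by rewrite Bc.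
  by exists (1 + h *: a) => //; apply: block_unit; rewrite affE.
- by rewrite /c !aff0 mulmx1.
have affd k (M : 'M[R]_k) : is_derive (0 : R) (1 : R) (aff k M) M.
  apply: (@is_derive_quadratic _ _ _ _ _ 0 1) => // h _.
  by rewrite /aff addr0 scale0r addr0 [1%:M + _]addrC addrK subrr normr0 mul0r.
by rewrite derive1E; have [_ ->] := is_derive_mulmx (affd _ B) (affd _ (blk a));
  rewrite !aff0 mulmx1 mul1mx addrC.
Qed.

Lemma lie_cliffG : lie (cliffG e m) = glO e (m := m).
Proof. by apply/seteqP; split; [exact: lie_cliffG_sub|exact: glO_lie]. Qed.

Lemma glO_conj g A : normalizesO g -> glO e A -> glO e (g *m A *m invmx g).
Proof.
move=> [gu gc gcV] [a [B [Bc ->]]]; have [d _ dE] := gc a.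
exists d, (g *m B *m invmx g); split; last by rewrite mulmxDr mulmxDl dE.
move=> i; have [y _ yE] := gcV (e i).
have giy : g *m blk y = blk (e i) *m g by rewrite yE !mulmxA mulmxV // mul1mx.
have yig : blk y *m invmx g = invmx g *m blk (e i) by rewrite yE mulmxK.
rewrite -mulmxA -yig !mulmxA -giy -!mulmxA; congr (_ *m _); rewrite !mulmxA.
by rewrite (commutesO_block e_sqr e_anti e_gen e_dim).
Qed.

Lemma planar_prolongation_act g T : normalizesO g ->
  planar_prolongation e T -> planar_prolongation e (tens_act g T).
Proof.
move=> gn [sT gT pT]; have [gu gc _] := gn; split.
- by move=> X Y; rewrite !tens_actE -!mulmxA; congr (_ *m _); exact: sT.
- by move=> X; rewrite tens_actE; exact: glO_conj.
move=> X; have [a aE] := pT (invmx g *m X); have [d _ dE] := gc a.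
exists d; rewrite tens_actE -!mulmxA aE dE !mulmxA //.
Qed.

End LieAlgebra.

(** * Connections and curves in charts *)

Section TensorAction.
Variables (R : realType) (n : nat).

Lemma invmxM (A B : 'M[R]_n) : A \in unitmx -> B \in unitmx ->
  invmx (A *m B) = invmx B *m invmx A.
Proof.
by move=> Au Bu; apply: invmx_eq; rewrite mulmxA -(mulmxA A) mulmxV // mulmx1 mulmxV.
Qed.

Lemma tens_actM (g h : 'M[R]_n) (T : tens R n) : g \in unitmx -> h \in unitmx ->
  tens_act (g *m h) T = tens_act g (tens_act h T).
Proof.
by move=> gu hu; apply/lfunP => X; rewrite !tens_actE invmxM // !mulmxA.
Qed.

Lemma tens_act1 (T : tens R n) : tens_act 1%:M T = T.
Proof.
by apply/lfunP => X; rewrite tens_actE invmx1 !mul1mx mulmx1.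
Qed.

Lemma tens_actK (g : 'M[R]_n) (T : tens R n) : g \in unitmx ->
  tens_act (invmx g) (tens_act g T) = T.
Proof.
by move=> gu; rewrite -tens_actM ?unitmx_inv // mulVmx // tens_act1.
Qed.

Lemma tens_actKV (g : 'M[R]_n) (T : tens R n) : g \in unitmx ->
  tens_act g (tens_act (invmx g) T) = T.
Proof.
by move=> gu; rewrite -tens_actM ?unitmx_inv // mulmxV // tens_act1.
Qed.

Lemma tens_act_linear (g : 'M[R]_n) : linear (tens_act g).
Proof.
move=> a T T'; apply/lfunP => X.
rewrite add_lfunE scale_lfunE !tens_actE add_lfunE scale_lfunE.
by rewrite mulmxDr mulmxDl -scalemxAr -scalemxAl.
Qed.

Lemma tens_actB (g : 'M[R]_n) T T' : tens_act g (T - T') = tens_act g T - tens_act g T'.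
Proof. by rewrite addrC -scaleN1r tens_act_linear scaleN1r addrC. Qed.

Lemma spencerB (T T' : tens R n) : spencer (T - T') = spencer T - spencer T'.
Proof.
apply: tens_inj => X Y; rewrite spencerE !add_lfunE !opp_lfunE !mulmxBl !spencerE.
by rewrite !opprD !opprK addrACA.
Qed.

Lemma spencer_act (g : 'M[R]_n) (T : tens R n) : g \in unitmx ->
  spencer (tens_act g T) = tens_act g (spencer T).
Proof.
move=> gu; apply: tens_inj => X Y.
by rewrite spencerE !tens_actE -!mulmxA -mulmxBr -spencerE.
Qed.

Lemma spencer_eq0 (T : tens R n) :
  spencer T = 0 <-> forall X Y : 'cV_n, T X *m Y = T Y *m X.
Proof.
split=> [T0 X Y|sT].
  by apply/eqP; rewrite -subr_eq0 -spencerE T0 zero_lfunE mul0mx.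
by apply: tens_inj => X Y; rewrite spencerE sT subrr zero_lfunE mul0mx.
Qed.

Lemma Ck_tens (V : normedModType R) r (U : set V) (T : tens R n) (v : V -> 'cV[R]_n) :
  open U -> Ck r U v -> Ck r U (fun x => T (v x)).
Proof.
move=> Uo /(Ck_mxP _ _ Uo) vr; apply/Ck_mxP => // i j.
apply: (@eq_Ck _ _ _ _ _ (fun x => \sum_k v x k 0 * T (delta_mx k 0) i j)) => //.
  move=> x _; rewrite [in RHS]tens_expand summxE; apply: eq_bigr => k _.
  by rewrite [RHS]mxE.
by apply: Ck_sum => // k; apply: CkM => //; exact: Ck_cst.
Qed.

Lemma derive_coord_sum (g : 'cV[R]_n -> R) x v : differentiable g x ->
  'D_v g x = \sum_k v k 0 * 'D_(delta_mx k 0) g x.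
Proof.
move=> gd; rewrite deriveE // {1}[v]matrix_sum_delta linear_sum.
by apply: eq_bigr => k _; rewrite big_ord1 linearZ /= -deriveE.
Qed.

Lemma is_derive_C1_comp (m k : nat) (U : set 'cV[R]_n) (g : 'cV[R]_n -> 'M[R]_(m, k))
    (c : R -> 'cV[R]_n) (t : R) d : open U -> Ck 1 U g -> U (c t) ->
  is_derive t (1 : R) c d -> is_derive t (1 : R) (g \o c) ('D_d g (c t)).
Proof.
move=> Uo g1 Uc [cd cE]; apply: is_derive_mx => i j.
have /(Ck_mxP _ _ Uo)/(_ i j) gij := g1.
have gd := C1_differentiable Uo gij Uc.
have := is_derive_comp gd cd; rewrite cE -derive_coord_sum //.
by rewrite derive_mx ?mxE //; exact: Ck_derivable g1 Uc.
Qed.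

End TensorAction.

Section Charts.
Variables (R : realType) (n : nat) (M : manifold R n).
Local Notation V := 'cV[R]_n.
Local Notation dom a := (cdom (atlas (m := M) a)).
Local Notation cod a := (ccod (atlas (m := M) a)).
Local Notation phi a := (cmap (atlas (m := M) a)).
Local Notation lap a b := (overlap (atlas (m := M) a) (atlas b)).
Local Notation tr a b := (transition (atlas (m := M) a) (atlas b)).

Lemma open_cod a : open (cod a).
Proof. exact: ccod_open. Qed.

Lemma open_overlap a b : open (lap a b).
Proof.
rewrite openE => y [ay by_]; rewrite /interior /overlap.
have ya : nbhs y (cod a).
  by apply: open_nbhs_nbhs; split => //; exact: ccod_open.
have yb : nbhs y (fun z => dom b (cinv (atlas a) z)).
  by apply: (cinv_cont ay); apply: open_nbhs_nbhs; split => //; exact: cdom_open.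
exact: (filterI ya yb).
Qed.

Lemma transition_cod a b y : lap a b y -> cod b (tr a b y).
Proof. by case=> _ /cmap_cod. Qed.

Lemma jac_smooth a b : smooth_on (lap a b) (@jac _ _ M a b).
Proof.
move=> r; apply/Ck_mxP; first exact: open_overlap.
move=> i j; apply: (@eq_Ck _ _ _ _ _ (fun y => ('D_(delta_mx j 0) (tr a b) y) i 0)).
- exact: open_overlap.
- by move=> y _; rewrite mxE.
have /Ck_mxP := Ck_derive (delta_mx j 0) (@atlas_smooth _ _ M a b r.+1).
by move=> /(_ (@open_overlap a b)); apply.
Qed.

Lemma derive_transition a b y (v : V) : lap a b y ->
  'D_v (tr a b) y = jac a b y *m v.
Proof.
move=> ly; have t1 := @atlas_smooth _ _ M a b 1.
have lo := @open_overlap a b.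
apply/matrixP => i j; rewrite (ord1 j) derive_mx; last exact: Ck_derivable t1 ly.
rewrite !mxE.
have /(Ck_mxP _ _ lo)/(_ i 0) ti := t1.
rewrite (derive_coord_sum _ (C1_differentiable lo ti ly)).
apply: eq_bigr => k _; rewrite mxE mulrC; congr (_ * _).
by rewrite derive_mx ?mxE //; exact: Ck_derivable t1 ly.
Qed.

Section Curve.
Variables (a : Defs.index M) (c : R -> V).
Hypothesis c_smooth : smooth_on setT c.
Hypothesis c_cod : forall h, cod a (c h).

Let curve h : M := cinv (atlas a) (c h).

Lemma chart_curve_continuous : continuous curve.
Proof.
move=> h; apply: (@continuous_comp _ _ _ c (cinv (atlas a))).
  exact: Ck_continuous (c_smooth 0) _.
exact: cinv_cont (c_cod h).
Qed.

Lemma chart_curve_smooth : smooth_curve curve.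
Proof.
split; first exact: chart_curve_continuous.
move=> b r; have Uo : open (curve @^-1` dom b).
  by apply: open_comp; [move=> h _; exact: chart_curve_continuous|exact: cdom_open].
apply: (@Ck_comp_mx _ _ _ _ _ _ (lap a b) _ (tr a b) c) => //.
- exact: open_overlap.
- exact: atlas_smooth.
by apply: Ck_subset (c_smooth r).
Qed.

Lemma acceleration_chart (Gamma : tens_field M) b h : is_connection Gamma ->
  dom b (curve h) ->
  let y := phi b \o curve in
  derive1 y h = jac a b (c h) *m derive1 c h /\
  derive1n 2 y h + Gamma b (y h) (derive1 y h) *m derive1 y h =
  jac a b (c h) *m
    (derive1n 2 c h + Gamma a (c h) (derive1 c h) *m derive1 c h).
Proof.
move=> [_ Gtr] bh y.
have lo := @open_overlap a b.
have cd t : is_derive t (1 : R) c (derive1 c t).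
  by rewrite derive1E; apply: derivableP; exact: Ck_derivable (c_smooth 1) _.
have c2d t : is_derive t (1 : R) (derive1 c) (derive1n 2 c t).
  rewrite /derive1n /= [derive1 (derive1 c) t]derive1E; apply: derivableP.
  have -> : derive1 c = 'D_1 c by apply: funext => s; rewrite derive1E.
  have c2 : Ck 1 setT ('D_(1 : R) c) := Ck_derive (1 : R) (c_smooth 2).
  exact: (Ck_derivable c2 I).
have lap_c t : dom b (curve t) -> lap a b (c t) by [].
have yd t : dom b (curve t) -> is_derive t (1 : R) y (jac a b (c t) *m derive1 c t).
  move=> bt; rewrite -derive_transition; last exact: lap_c.
  exact: (is_derive_C1_comp lo (@atlas_smooth _ _ M a b 1) (lap_c t bt) (cd t)).
have y1 t : dom b (curve t) -> derive1 y t = jac a b (c t) *m derive1 c t.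
  by move=> bt; rewrite derive1E; have [_ ->] := yd t bt.
have y2 : derive1n 2 y h = 'D_(derive1 c h) (jac a b) (c h) *m derive1 c h +
    jac a b (c h) *m derive1n 2 c h.
  rewrite /derive1n /= derive1E.
  have Jd := is_derive_C1_comp lo (@jac_smooth a b 1) (lap_c h bh) (cd h).
  have := is_derive_mulmx Jd (c2d h).
  move/(near_eq_is_derive (g := derive1 y)) => [|_ ->] //.
  have Uo : open (curve @^-1` dom b).
    by apply: open_comp; [move=> t _; exact: chart_curve_continuous|exact: cdom_open].
  have := open_nbhs_nbhs (conj Uo bh); apply: filterS => t bt.
  by rewrite y1.
split; first exact: y1.
rewrite y2 y1 // mulmxDr !mulmxA -/(tr a b (c h)).
rewrite -[y h]/(tr a b (c h)) Gtr; last exact: lap_c.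
by rewrite mulmxBl !addrA [_ + jac a b _ *m _]addrC addrAC addrK.
Qed.

End Curve.
End Charts.

(** * Almost Cliffordian manifolds *)

Section AlmostClifford.
Variables (R : realType) (s t m : nat) (O : falgType R) (e : 'I_(s + t) -> O).
Hypothesis cliffO : clifford e.
Local Notation n := (2 ^ (s + t) * m)%N.
Local Notation V := 'cV[R]_n.
Local Notation b := (tnth (std_basis e)).
Local Notation blk := (block e m).

Lemma clifford_gen_sqr i : exists c : bool, e i * e i = (-1) ^+ c.
Proof.
rewrite (clifford_sqr cliffO); exists (~~ (i < s)%N); case: ifP => _ /=.
  by rewrite expr0.
by rewrite expr1.
Qed.

Let e_sqr := clifford_gen_sqr.
Let e_anti := clifford_anti cliffO.
Let e_gen := clifford_gen cliffO.
Let e_dim := clifford_dim cliffO.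

Let lieE := lie_cliffG e_sqr e_anti e_gen e_dim m.

(* Identifies V^* with O^m by the basis of V. Any linear isomorphism would do:
   the bundle only needs V^* as typical fibre, not as a G-module. *)
Definition form_tuple (l : 'Hom(V, R^o)) : 'I_m -> O :=
  fun q => \sum_i (l (emb e (b i) q) : R) *: b i.

Lemma form_tuple_surj nu : exists l, form_tuple l = nu.
Proof.
pose f (X : V) : R^o :=
  \sum_q \sum_i vec_mx X^T i q * coord (std_basis e) i (nu q).
have fl : linear f.
  move=> a X Y; rewrite /f scaler_sumr -big_split; apply: eq_bigr => q _ /=.
  rewrite scaler_sumr -big_split; apply: eq_bigr => i _ /=.
  by rewrite !linearP /= !mxE mulrDl -mulrA.
pose fL := HB.pack_for {linear V -> R^o} f
  (GRing.isLinear.Build _ _ _ _ f fl).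
exists (linfun fL); apply: funext => q; rewrite /form_tuple.
rewrite [RHS](sum_coordb e_sqr e_anti e_gen e_dim); apply: eq_bigr => i _.
congr (_ *: _); rewrite lfunE /= /f.
have E j k : vec_mx (emb e (b i) q)^T j k = ((j == i) && (k == q))%:R.
  rewrite /emb /of_tuple trmxK mxvecK mxE; case: (k == q); last first.
    by rewrite linear0 andbF.
  rewrite andbT -(coordb_sum e_sqr e_anti e_gen e_dim (fun j => (j == i)%:R)).
  congr (coord _ _ _); rewrite (bigD1 i) //= eqxx scale1r big1 ?addr0 //.
  by move=> a /negPf->; rewrite scale0r.
rewrite (bigD1 q) //= [X in _ + X]big1 ?addr0 => [|k /negPf kq]; last first.
  by rewrite big1 // => j _; rewrite E kq andbF mul0r.
rewrite (bigD1 i) //= big1 ?addr0 => [|j /negPf ji]; last by rewrite E ji mul0r.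
by rewrite E !eqxx mul1r.
Qed.

Lemma form_tuple_linear a l l' q :
  form_tuple (a *: l + l') q = a *: form_tuple l q + form_tuple l' q.
Proof.
rewrite /form_tuple scaler_sumr -big_split; apply: eq_bigr => i _ /=.
by rewrite add_lfunE scale_lfunE scalerDl scalerA.
Qed.

Lemma form_tuple_eq0 l : form_tuple l = (fun=> 0) -> l = 0.
Proof.
move=> l0; apply/lfunP => X; rewrite zero_lfunE (sum_emb e_sqr e_anti e_gen e_dim X).
rewrite linear_sum big1 // => q _; rewrite linear_sum big1 // => i _.
rewrite linearZ /=; suff -> : l (emb e (b i) q) = 0 by rewrite scaler0.
have := congr1 (coord (std_basis e) i) (congr1 (@^~ q) l0).
by rewrite /form_tuple (coordb_sum e_sqr e_anti e_gen e_dim) linear0.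
Qed.

Definition fiber_map (u : 'M[R]_n) : 'Hom('Hom(V, R^o), tens R n) :=
  linfun (fun l => tens_act u (proj_tens e (form_tuple l))).

Lemma fiber_mapE u l : fiber_map u l = tens_act u (proj_tens e (form_tuple l)).
Proof.
pose f l := tens_act u (proj_tens e (form_tuple l)).
have fl : linear f.
  move=> a x y; rewrite /f -tens_act_linear; congr tens_act.
  rewrite -(proj_tens_linear e_sqr e_anti e_gen e_dim); congr proj_tens.
  by apply: funext => q; rewrite form_tuple_linear.
pose fL := HB.pack_for {linear 'Hom(V, R^o) -> tens R n} f
  (GRing.isLinear.Build _ _ _ _ f fl).
exact: (lfunE fL).
Qed.

Lemma fiber_map_inj u : u \in unitmx -> lker (fiber_map u) = 0%VS.
Proof.
move=> uu; apply/eqP; rewrite -subv0; apply/subvP => l.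
rewrite memv_ker fiber_mapE memv0 => /eqP u0; apply/eqP.
apply: form_tuple_eq0; apply: (proj_tens_eq0 e_sqr e_anti e_gen e_dim).
rewrite -(tens_actK (proj_tens _ _) uu) u0.
by apply/lfunP => X; rewrite tens_actE !zero_lfunE mulmx0 mul0mx.
Qed.

Lemma mem_fiber_map u T : u \in unitmx ->
  T \in limg (fiber_map u) <-> planar_prolongation e (tens_act (invmx u) T).
Proof.
move=> uu; split.
  case/memv_imgP => l _ ->; rewrite fiber_mapE tens_actK //.
  exact: proj_tens_planar.
case/(planar_prolongationP e_sqr e_anti e_gen e_dim) => nu E.
have [l lE] := form_tuple_surj nu.
by apply/memv_imgP; exists l; [exact: memvf|]; rewrite fiber_mapE lE -E tens_actKV.
Qed.

Variables (M : manifold R n) (P : Gstructure M (cliffG e m)).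
Local Notation dom a := (cdom (atlas (m := M) a)).
Local Notation cod a := (ccod (atlas (m := M) a)).
Local Notation phi a := (cmap (atlas (m := M) a)).
Local Notation lap a b := (overlap (atlas (m := M) a) (atlas b)).
Local Notation tr a b := (transition (atlas (m := M) a) (atlas b)).
Local Notation A0 := (cliffA e m).

Lemma cliffG1 : cliffG e m 1%:M.
Proof.
exists 1%:M, 1%:M; split; last by rewrite mulmx1.
  by split; [rewrite unitmx1|move=> i; rewrite mul1mx mulmx1].
by exists 1; rewrite ?unitr1 // (block1 e_sqr e_anti e_gen e_dim).
Qed.

Lemma normalizesM (g h : 'M[R]_n) :
  normalizesO e g -> normalizesO e h -> normalizesO e (g *m h).
Proof.
move=> [gu gc gcV] [hu hc hcV]; split=> [|x|x]; first by rewrite unitmx_mul gu.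
  have [y _ yE] := hc x; have [z _ zE] := gc y; exists z => //.
  by rewrite zE yE invmxM // !mulmxA.
have [y _ yE] := gcV x; have [z _ zE] := hcV y; exists z => //.
by rewrite zE yE invmxM // !mulmxA.
Qed.

Lemma frame_unit a y u : cod a y -> frames P a y u -> u \in unitmx.
Proof.
move=> ay; have [u0 u0u ->] := frames_orbit P ay => -[g].
case/(cliffG_normalizes e_sqr e_anti e_gen e_dim) => gu _ _ <-.
by rewrite unitmx_mul u0u.
Qed.

Lemma frame_exists a y : cod a y -> exists u, frames P a y u.
Proof.
move=> ay; have [u0 u0u ->] := frames_orbit P ay.
by exists (u0 *m 1%:M); exists 1%:M => //; exact: cliffG1.
Qed.

Lemma frame_change a y u u' : cod a y -> frames P a y u -> frames P a y u' ->
  exists2 g, normalizesO e g & u' = u *m g.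
Proof.
move=> ay; have [u0 u0u ->] := frames_orbit P ay => -[g gG <-] [g' g'G <-].
have gN := cliffG_normalizes e_sqr e_anti e_gen e_dim gG.
have g'N := cliffG_normalizes e_sqr e_anti e_gen e_dim g'G.
exists (invmx g *m g'); first by apply: normalizesM => //; exact: normalizesV.
by rewrite -!mulmxA mulKVmx //; case: gN.
Qed.

Lemma jac_unit a b y : lap a b y -> jac a b y \in unitmx.
Proof.
move=> aby; have [ay _] := aby; have [u ua] := frame_exists ay.
have := frames_chart P aby => fE.
have : frames P b (tr a b y) (jac a b y *m u) by rewrite fE; exists u.
by move/(frame_unit (transition_cod aby)); rewrite unitmx_mul => /andP[].
Qed.

Lemma frame_jac a b y u : lap a b y -> frames P a y u ->
  frames P b (tr a b y) (jac a b y *m u).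
Proof. by move=> aby ua; rewrite (frames_chart P aby); exists u. Qed.

(* The model space of tensors is G-invariant, so the fibre does not depend on
   the frame. *)
Lemma planar_prolongation_frame a y u u' T : cod a y ->
  frames P a y u -> frames P a y u' ->
  planar_prolongation e (tens_act (invmx u) T) ->
  planar_prolongation e (tens_act (invmx u') T).
Proof.
move=> ay ua ua' pT; have [g gN u'E] := frame_change ay ua ua'.
have uu := frame_unit ay ua; have [gu _ _] := gN.
rewrite u'E invmxM // tens_actM ?unitmx_inv //.
exact: (planar_prolongation_act e_sqr e_anti e_gen e_dim (normalizesV gN) pT).
Qed.

(* xget picks an arbitrary frame; its default value 1 is never used on the
   codomain of the chart. *)
Definition prolongation_fiber (a : Defs.index M) (y : V) : {vspace tens R n} :=
  limg (fiber_map (xget 1%:M (frames P a y))).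

Lemma mem_prolongation_fiber a y u T : cod a y -> frames P a y u ->
  T \in prolongation_fiber a y <-> planar_prolongation e (tens_act (invmx u) T).
Proof.
move=> ay ua; have xa : frames P a y (xget 1%:M (frames P a y)).
  exact: (xgetPex 1%:M (ex_intro _ u ua)).
rewrite (mem_fiber_map _ (frame_unit ay xa)).
split; first exact: (planar_prolongation_frame ay xa ua).
exact: (planar_prolongation_frame ay ua xa).
Qed.

Lemma prolongation_fiber_trivial a y : cod a y ->
  exists (W : set V) (f : V -> 'Hom('Hom(V, R^o), tens R n)),
    [/\ open W, W y, W `<=` cod a,
        forall l X, smooth_on W (fun z => f z l X) &
        forall z, W z -> lker (f z) = 0%VS /\ limg (f z) = prolongation_fiber a z].
Proof.
move=> ay; have [W [u [Wo Wy Wa us uf]]] := frames_smooth P ay.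
have uu z : W z -> u z \in unitmx by move=> Wz; apply: frame_unit (uf z Wz); exact: Wa.
exists W, (fun z => fiber_map (u z)); split=> // [l X r|z Wz].
  have uV := Ck_invmx Wo uu (us r).
  have uVX := Ck_mulmx Wo uV (Ck_cst r W X).
  have := Ck_mulmx Wo (Ck_mulmx Wo (us r)
    (Ck_tens (proj_tens e (form_tuple l)) Wo uVX)) uV.
  by apply: eq_Ck => // z _; rewrite fiber_mapE tens_actE.
split; first exact/fiber_map_inj/uu.
apply/vspaceP => T; apply/idP/idP => H.
  by apply/(mem_prolongation_fiber T (Wa z Wz) (uf z Wz))/(mem_fiber_map T (uu z Wz)).
by apply/(mem_fiber_map T (uu z Wz))/(mem_prolongation_fiber T (Wa z Wz) (uf z Wz)).
Qed.

Lemma prolongation_fiber_chart a b y : lap a b y -> forall T,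
  (tens_act (jac a b y) T \in prolongation_fiber b (tr a b y)) =
  (T \in prolongation_fiber a y).
Proof.
move=> aby T; have [ay _] := aby; have [u ua] := frame_exists ay.
have uu := frame_unit ay ua; have Ju := jac_unit aby.
have Jua := frame_jac aby ua.
have E : tens_act (invmx (jac a b y *m u)) (tens_act (jac a b y) T) =
    tens_act (invmx u) T.
  by rewrite invmxM // tens_actM ?unitmx_inv // tens_actK.
have H1 := mem_prolongation_fiber (tens_act (jac a b y) T) (transition_cod aby) Jua.
have H2 := mem_prolongation_fiber T ay ua.
rewrite E in H1.
by apply/idP/idP => H; [apply/H2/H1|apply/H1/H2].
Qed.

Definition prolongation_bundle : tens_bundle M 'Hom(V, R^o) :=
  TensBundle prolongation_fiber_trivial prolongation_fiber_chart.

Lemma AfiberP a y u F : cod a y -> frames P a y u ->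
  Afiber P A0 a y F <-> A0 (invmx u *m F *m u).
Proof.
move=> ay ua; have uu := frame_unit ay ua; split.
  move=> [u' [B [ua' [x _ <-] ->]]].
  have [g [gu gc _] u'E] := frame_change ay ua ua'.
  have [z _ zE] := gc x; exists z => //.
  by rewrite zE u'E invmxM // !mulmxA mulVmx // mul1mx mulmxKV.
move=> FA; exists u, (invmx u *m F *m u); split => //.
by rewrite !mulmxA mulmxV // mul1mx mulmxK.
Qed.

Lemma cliffA_linear c A B : A0 A -> A0 B -> A0 (c *: A + B).
Proof.
move=> [x _ <-] [y _ <-]; exists (c *: x + y) => //.
exact: (block_linear e_sqr e_anti e_gen e_dim).
Qed.

Lemma Afiber_linear a y c F F' : cod a y ->
  Afiber P A0 a y F -> Afiber P A0 a y F' -> Afiber P A0 a y (c *: F + F').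
Proof.
move=> ay; have [u ua] := frame_exists ay.
move=> /(AfiberP _ ay ua) FA /(AfiberP _ ay ua) F'A; apply/(AfiberP _ ay ua).
rewrite mulmxDr mulmxDl -scalemxAr -scalemxAl.
exact: cliffA_linear.
Qed.

Lemma Afiber_scalar a y (c : R) : cod a y -> Afiber P A0 a y (c *: 1%:M).
Proof.
move=> ay; have [u ua] := frame_exists ay; apply/(AfiberP _ ay ua).
exists (c *: 1) => //; rewrite (blockZ e_sqr e_anti e_gen e_dim).
rewrite (block1 e_sqr e_anti e_gen e_dim) -scalemxAr -scalemxAl mulmx1.
by rewrite mulVmx //; exact: frame_unit ua.
Qed.

Lemma connection_preserves Gamma : connection_on P Gamma -> preserves P A0 Gamma.
Proof.
move=> [_ Gu] a W F Wo Wa Fs FA z Wz X.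
have az := Wa z Wz.
have [W1 [u [W1o W1z W1a us uf]]] := frames_smooth P az.
pose W2 := W `&` W1.
have W2o : open W2 by exact: openI.
have W2z : W2 z by [].
have us2 : Ck 1 W2 u by apply: Ck_subset (us 1) => y [].
have Fs2 : Ck 1 W2 F by apply: Ck_subset (Fs 1) => y [].
have uu y : W2 y -> u y \in unitmx.
  by move=> [Wy W1y]; apply: frame_unit (uf y W1y); exact: Wa.
pose B y := invmx (u y) *m F y *m u y.
have B1 : Ck 1 W2 B.
  by apply: (Ck_mulmx W2o _ us2); apply: (Ck_mulmx W2o _ Fs2); exact: Ck_invmx.
have Bd : derivable B z X by exact: Ck_derivable B1 W2z.
have BA : A0 ('D_X B z).
  apply: range_block_derive => //.
  have := open_nbhs_nbhs (conj W2o W2z); apply: filterS => y [Wy W1y].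
  by apply/(AfiberP _ (Wa y Wy) (uf y W1y)); exact: FA.
have ud : derivable u z X by exact: Ck_derivable us2 W2z.
have Fd : derivable F z X by exact: Ck_derivable Fs2 W2z.
have d1 := is_derive_mulmx (derivableP Fd) (derivableP ud).
have d2 := is_derive_mulmx (derivableP ud) (derivableP Bd).
have dE : 'D_X F z *m u z + F z *m 'D_X u z = 'D_X u z *m B z + u z *m 'D_X B z.
  have : {near z, (fun y => F y *m u y) =1 (fun y => u y *m B y)}.
    have := open_nbhs_nbhs (conj W2o W2z); apply: filterS => y W2y.
    by rewrite /B !mulmxA mulmxV ?uu // mul1mx.
  by move/near_eq_derive => /(_ X); case: d1 => _ ->; case: d2 => _ ->.
pose w := invmx (u z) *m ('D_X u z + Gamma a z X *m u z).
have : glO e w by rewrite -lieE; apply: (Gu a W1 u).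
move=> [x [B0 [B0c wE]]].
have [x' _ x'E] : A0 (B z) by apply/(AfiberP _ az (uf z W1z)); exact: FA.
have wB : A0 (w *m B z - B z *m w).
  exists (x * x' - x' * x) => //.
  rewrite (blockB e_sqr e_anti e_gen e_dim) !(blockM e_sqr e_anti e_gen e_dim).
  rewrite wE -x'E mulmxDl mulmxDr (commutesO_block e_sqr e_anti e_gen e_dim _ B0c).
  by rewrite opprD addrACA subrr addr0.
apply/(AfiberP _ az (uf z W1z)).
have uz := uu z W2z.
suff -> : invmx (u z) *m ('D_X F z + Gamma a z X *m F z - F z *m Gamma a z X) *m u z =
    'D_X B z + (w *m B z - B z *m w).
  by rewrite -['D_X B z]scale1r; apply: cliffA_linear.
rewrite -mulmxA; apply: (canLR (mulKmx uz)).
have uw : u z *m w = 'D_X u z + Gamma a z X *m u z by rewrite mulKVmx.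
have uB : u z *m B z = F z *m u z by rewrite /B !mulmxA mulmxV // mul1mx.
clearbody w B; rewrite [RHS]mulmxDr mulmxBr !mulmxA uw uB -(mulmxA _ (u z)) uw.
rewrite mulmxBl !mulmxDl mulmxDr -(mulmxA (Gamma a z X) (u z)) uB !mulmxA.
have -> : 'D_X F z *m u z = 'D_X u z *m B z + u z *m 'D_X B z - F z *m 'D_X u z.
  by rewrite -dE addrK.
by apply/matrixP => i j; rewrite !mxE; ring.
Qed.

Section Classification.
Variables (D : {vspace tens R n}).
Hypothesis complD : invariant_complement (cliffG e m) D.
Variable nabla : tens_field M.
Hypothesis nablaD : D_connection P D nabla.

Lemma smooth_fieldB (S T : tens_field M) : smooth_field S -> smooth_field T ->
  smooth_field (fun a y => S a y - T a y).
Proof.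
move=> Ss Ts a X r; have ao := @open_cod _ _ M a.
apply: (@eq_Ck _ _ _ _ _ (fun y => S a y X - T a y X)) => //.
  by move=> y _; rewrite add_lfunE opp_lfunE.
by apply: CkB => //; [exact: Ss|exact: Ts].
Qed.

Lemma connection_difference (nabla' : tens_field M) : is_connection nabla' ->
  is_tensor (fun a y => nabla' a y - nabla a y).
Proof.
move=> [s' tr']; have [[[s0 tr0] _] _] := nablaD.
split; first exact: smooth_fieldB.
move=> a c y acy; have Ju := jac_unit acy.
apply/lfunP => Z; rewrite tens_actE !add_lfunE !opp_lfunE.
rewrite -{1 2}(mulKVmx Ju Z); set X := invmx _ *m Z.
apply: (can_inj (mulmxK Ju)); rewrite mulmxKV // mulmxBl tr' // tr0 //.
by rewrite mulmxBr opprB addrA subrK.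
Qed.

Lemma D_connection_section (S : tens_field M) (nabla' : tens_field M) :
  section_of prolongation_bundle S ->
  (forall a y, cod a y -> nabla' a y = nabla a y + S a y) ->
  D_connection P D nabla'.
Proof.
move=> [[Ss St] Sf] nE.
have [[[s0 tr0] c0] t0] := nablaD.
have Sp a y u : cod a y -> frames P a y u ->
    planar_prolongation e (tens_act (invmx u) (S a y)).
  by move=> ay ua; apply/(mem_prolongation_fiber _ ay ua)/Sf.
split.
  split; first split.
  - move=> a X r; have ao := @open_cod _ _ M a.
    apply: (@eq_Ck _ _ _ _ _ (fun y => nabla a y X + S a y X)) => //.
      by move=> y ay; rewrite nE // add_lfunE.
    by apply: CkD => //; [exact: s0|exact: Ss].
  - move=> a c y acy X; have [ay _] := acy.
    rewrite !nE //; last exact: transition_cod.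
    rewrite !add_lfunE mulmxDl tr0 // St // tens_actE.
    have Ju := jac_unit acy.
    by rewrite mulKmx // mulmxKV // mulmxDr addrAC.
  move=> a W u Wo Wa us uf z Wz X.
  have az := Wa z Wz; have uz := frame_unit az (uf z Wz).
  rewrite nE // add_lfunE mulmxDl addrA mulmxDr lieE -[X in glO _ X]addrC.
  rewrite -[_ *m (S a z X *m _)]scale1r; apply: glO_linear => //.
    have [_ /(_ (invmx (u z) *m X)) + _] := Sp a z _ az (uf z Wz).
    by rewrite tens_actE invmxK mulKVmx // mulmxA.
  by rewrite -lieE; apply: c0 Wz X.
move=> a y u ay ua; have uu := frame_unit ay ua.
suff E : spencer (nabla' a y) = spencer (nabla a y).
  by rewrite /torsion_function E; exact: t0.
apply/eqP; rewrite -subr_eq0 -spencerB nE // addrAC subrr add0r; apply/eqP.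
rewrite -(tens_actKV (S a y) uu) spencer_act //.
have [sS _ _] := Sp a y u ay ua.
rewrite ((spencer_eq0 _).2 sS); apply/lfunP => X.
by rewrite tens_actE !zero_lfunE mulmx0 mul0mx.
Qed.

Lemma same_planar_section (S : tens_field M) (nabla' : tens_field M) :
  section_of prolongation_bundle S ->
  (forall a y, cod a y -> nabla' a y = nabla a y + S a y) ->
  same_planar_curves P A0 nabla nabla'.
Proof.
move=> [_ Sf] nE c _.
have SF a y X : cod a y -> exists2 F, Afiber P A0 a y F & S a y X *m X = F *m X.
  move=> ay; have [u ua] := frame_exists ay; have uu := frame_unit ay ua.
  have /(mem_prolongation_fiber _ ay ua)[_ _ pS] := Sf a y ay.
  have [x xE] := pS (invmx u *m X).
  exists (u *m blk x *m invmx u); first by exists u, (blk x); split => //; exists x.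
  move: xE; rewrite tens_actE invmxK mulKVmx // -!mulmxA mulKVmx //.
  by move=> /(congr1 (mulmx u)); rewrite mulKVmx.
split=> pc a h ah y; have ay : cod a (y h) by exact: cmap_cod.
- have [F FA FE] := pc a h ah; rewrite -/y in FA FE.
  have [F' F'A F'E] := SF a (y h) (derive1 y h) ay.
  exists (1 *: F + F'); first exact: Afiber_linear.
  by rewrite nE // add_lfunE mulmxDl addrA FE F'E scale1r mulmxDl.
have [F FA FE] := pc a h ah; rewrite -/y in FA FE.
  have [F' F'A F'E] := SF a (y h) (derive1 y h) ay.
exists (-1 *: F' + F); first exact: Afiber_linear.
rewrite mulmxDl scaleN1r mulNmx -F'E -FE nE // add_lfunE mulmxDl.
by rewrite [RHS]addrC addrA addrK.
Qed.

Lemma planar_difference (nabla' : tens_field M) a y (X : V) :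
  same_planar_curves P A0 nabla nabla' -> cod a y ->
  exists2 F, Afiber P A0 a y F & (nabla' a y - nabla a y) X *m X = F *m X.
Proof.
move=> same ay; have [[nc _] _] := nablaD; have [ns _] := nc.
have [c [k [k0 cs cU [c0 c1] cg]]] :=
  geodesic_exists X (@open_cod _ _ M a) (ns a) ay.
pose g h : M := cinv (atlas a) (c h).
have g_planar : planar P A0 nabla g.
  move=> d h dh; have [y1 y2] := acceleration_chart cs cU nc dh.
  have [r rE] := cg h; exists (r *: 1%:M).
    by apply: Afiber_scalar; exact: cmap_cod.
  by rewrite y2 rE -scalemxAr -y1 -scalemxAl mul1mx.
have [g_planar' _] := same g (chart_curve_smooth cs cU).
have ga h : phi a (g h) = c h by apply: cinvK; exact: cU.
have gd : dom a (g 0) by apply: cinv_dom; exact: cU.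
have [F FA] := g_planar' g_planar a 0 gd.
have -> : phi a \o g = c by apply: funext => h; exact: ga.
rewrite /= ga c0 in FA *; move=> FE; have [r rE] := cg 0.
rewrite c0 /derive1n /= in rE; rewrite c1 in FE rE.
exists (k^-1 *: (- r *: 1%:M + F) + 0).
  have z0 : Afiber P A0 a y 0.
    by have := Afiber_scalar 0 ay; rewrite scale0r.
  have one : Afiber P A0 a y 1%:M by have := Afiber_scalar 1 ay; rewrite scale1r.
  by apply: Afiber_linear => //; apply: Afiber_linear.
set T := _ - _; have E : T (k *: X) *m (k *: X) = (- r *: 1%:M + F) *m (k *: X).
  rewrite mulmxDl -scalemxAl mul1mx scaleNr -rE -FE.
  by rewrite /T add_lfunE opp_lfunE mulmxBl [RHS]addrC opprD addrACA subrr add0r.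
apply: (scalerI k0); rewrite addr0.
rewrite -[in RHS]scalemxAl scalerA divff // scale1r.
apply: (scalerI k0); move: E; rewrite -!scalemxAr.
have -> : T (k *: X) = k *: T X by rewrite linearZ.
by rewrite -scalemxAl => ->.
Qed.

Lemma difference_section (nabla' : tens_field M) :
  D_connection P D nabla' -> same_planar_curves P A0 nabla nabla' ->
  section_of prolongation_bundle (fun a y => nabla' a y - nabla a y).
Proof.
move=> nD' same; have [[nc' cf'] t'] := nD'; have [[nc cf] t0] := nablaD.
split; first exact: connection_difference.
move=> a y ay; have [W [u [Wo Wy Wa us uf]]] := frames_smooth P ay.
have ua := uf y Wy; have uu := frame_unit ay ua.
set T := _ - _.
apply/(mem_prolongation_fiber _ ay ua).
have TX X : tens_act (invmx (u y)) T X = invmx (u y) *m T (u y *m X) *m u y.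
  by rewrite tens_actE invmxK.
have gT X : glO e (tens_act (invmx (u y)) T X).
  rewrite TX -mulmxA /T add_lfunE opp_lfunE mulmxBl mulmxBr.
  have h1 := cf' a W u Wo Wa us uf y Wy (u y *m X).
  have h0 := cf a W u Wo Wa us uf y Wy (u y *m X).
  rewrite lieE in h1 h0; have := glO_linear e_sqr e_anti e_gen e_dim (-1) h0 h1.
  by rewrite scaleN1r !mulmxDr opprD addrACA addNr add0r addrC.
split=> //.
  apply/spencer_eq0; apply: (ic_direct complD) => [X|].
    by rewrite lieE; exact: gT.
  rewrite spencer_act ?unitmx_inv // spencerB tens_actB.
  by rewrite rpredB //; [exact: t'|exact: t0].
move=> X; have [F FA FE] := planar_difference (u y *m X) same ay.
have [x _ xE] := (AfiberP F ay ua).1 FA.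
exists x; rewrite TX -!mulmxA FE !mulmxA -xE //.
Qed.

End Classification.

End AlmostClifford.

Theorem corollary5p4 (R : realType) (s t m : nat) (O : falgType R)
    (e : 'I_(s + t) -> O) (cliffO : clifford e)
    (dimM : (2 * (s + t) <= 2 ^ (s + t) * m)%N)
    (M : manifold R (2 ^ (s + t) * m))
    (P : Gstructure M (cliffG e m))
    (D : {vspace tens R (2 ^ (s + t) * m)})
    (complD : invariant_complement (cliffG e m) D)
    (nabla : tens_field M) (nablaD : D_connection P D nabla) :
  exists E : tens_bundle M 'Hom('cV[R]_(2 ^ (s + t) * m), R^o),
    forall nabla' : tens_field M,
      [/\ D_connection P D nabla', preserves P (cliffA e m) nabla' &
          same_planar_curves P (cliffA e m) nabla nabla'] <->
      exists2 S : tens_field M, section_of E S &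
        forall a y, ccod (atlas a) y -> nabla' a y = nabla a y + S a y.
Proof.
exists (prolongation_bundle cliffO P) => nabla'; split.
  case=> nD' _ same.
  exists (fun a y => nabla' a y - nabla a y).
    exact: (difference_section cliffO complD nablaD nD' same).
  by move=> a y _; rewrite addrC subrK.
case=> S SE nE.
have nD' := D_connection_section nablaD SE nE.
split=> //; first by apply: connection_preserves => //; case: nD'.
exact: same_planar_section SE nE.
Qed.
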